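(* Let $n$ be a positive integer and let $\mathbb{J}$ be the $n\times n$ matrix with all entries on the super-diagonal equal to $1$ and all other entries equal to zero. Let $\gamma$ be a positive real number, let $R$ be an arbitrary deterministic $n\times n$ matrix where each entry is $\pm n^{-\gamma}$, and let $P$ be the $n\times n$ matrix with entry $(n,1)$ equal to $n^{-\gamma}$ and all other entries zero. (i) If $n \le \frac{\gamma \log \gamma - \log 3}{\log 5}$ and $n \ge 7$, then for any smooth function $\varphi: \mathbb{C} \to \mathbb{C}$ with support of $\Delta \varphi$ contained in $\{z \in \mathbb{C} : 1/5 \le |z| < 1/4\}$, we have \[ \left| \sum_{i=1}^n \bigl(\varphi(\lambda_i(\mathbb{J}+R)) - \varphi(\lambda_i(\mathbb{J}+P))\bigr) \right| \le 3 \|\Delta \varphi\|_\infty. \] (ii) If $n\ge 2 \gamma\log \gamma$ and $\gamma \ge 5$, then for any smooth function $\varphi: \mathbb{C} \to \mathbb{C}$ with support of $\Delta \varphi$ contained in $\{z \in \mathbb{C} : |z| < 1/4\}$, we have \[ \left| \sum_{i=1}^n \varphi(\lambda_i(\mathbb{J}+R)) \right| \le 3 \|\Delta \varphi\|_\infty. \]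
   Context: $\lambda_1(M),\dots,\lambda_n(M)$ are the eigenvalues of the $n\times n$ matrix $M$ counted with algebraic multiplicity; $\Delta$ is the Laplacian on $\mathbb{C}\cong\mathbb{R}^2$; $\|\Delta\varphi\|_\infty$ is the $L^\infty$-norm of $\Delta\varphi$; $\log$ is the natural logarithm.
   Formalization: In both parts φ is additionally assumed to have compact support; without this the claim fails (φ = 1 in (ii), φ(z) = z in (i), both with Δφ = 0). *)

(* Defs.v *)
From HB Require Import structures.
From mathcomp Require Import all_boot all_order all_algebra.
From mathcomp Require Import complex.
From mathcomp Require Import all_classical all_reals all_analysis.
Import Order.TTheory GRing.Theory Num.Theory.
Import numFieldNormedType.Exports.

Set Implicit Arguments.
Unset Strict Implicit.
Unset Printing Implicit Defensive.

Local Open Scope classical_set_scope.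
Local Open Scope ring_scope.
Local Open Scope complex_scope.

Definition superdiag_mx (C : pzRingType) (n : nat) : 'M[C]_n :=
  \matrix_(i < n, j < n) (j == i.+1 :> nat)%:R.

(* The 1-based position (n, 1) is the last row and the first column. *)
Definition corner_mx (C : pzRingType) (n : nat) (c : C) : 'M[C]_n :=
  \matrix_(i < n, j < n)
    (if (i == n.-1 :> nat) && (j == 0%N :> nat) then c else 0).

(* Eigenvalues listed with algebraic multiplicity, in an arbitrary order:     *)
(* char_poly M = \prod_(z <- eigenvalues M) ('X - z%:P), as char_poly M is    *)
(* monic; in particular the list has size n.                                  *)
Definition eigenvalues (C : closedFieldType) (n : nat) (M : 'M[C]_n) : seq C :=
  sval (closed_field_poly_normal (char_poly M)).

Section Plane.
Variable R : realType.

(* Differentiability over R, topology and Lebesgue measure on the complex     *)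
(* plane are those of R * R: the library has no real normed structure and no  *)
(* measurable structure on R[i].                                              *)
Definition plane (p : R * R) : R[i] := p.1 +i* p.2.

Definition Re_part (phi : R[i] -> R[i]) (p : R * R) : R :=
  complex.Re (phi (plane p)).
Definition Im_part (phi : R[i] -> R[i]) (p : R * R) : R :=
  complex.Im (phi (plane p)).

Definition partial_x (f : R * R -> R) (p : R * R) : R := 'D_(1, 0) f p.
Definition partial_y (f : R * R -> R) (p : R * R) : R := 'D_(0, 1) f p.

Fixpoint C_k (k : nat) (f : R * R -> R) : Prop :=
  if k is k'.+1 then
    [/\ continuous f,
        forall p, derivable f p (1, 0),
        forall p, derivable f p (0, 1),
        C_k k' (partial_x f) &
        C_k k' (partial_y f)]
  else continuous f.

Definition smooth (phi : R[i] -> R[i]) : Prop :=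
  forall k, C_k k (Re_part phi) /\ C_k k (Im_part phi).

Definition real_laplacian (f : R * R -> R) (p : R * R) : R :=
  partial_x (partial_x f) p + partial_y (partial_y f) p.

Definition laplacian (phi : R[i] -> R[i]) (z : R[i]) : R[i] :=
  real_laplacian (Re_part phi) (complex.Re z, complex.Im z) +i*
  real_laplacian (Im_part phi) (complex.Re z, complex.Im z).

(* Test functions phi are taken with compact csupport phi. A condition on     *)
(* csupport (laplacian phi) alone allows harmonic phi, for which the Laplacian *)
(* vanishes, whereas the sum of the phi (lambda_i M) is n for phi = 1 and the  *)
(* trace of M for phi = id.                                                   *)
Definition csupport (f : R[i] -> R[i]) : set (R * R) :=
  closure [set p | f (plane p) != 0].

Definition Linfty_norm (f : R[i] -> R[i]) : \bar R :=
  Lnorm (lebesgue_measure \x lebesgue_measure)%E +oo%E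
    (fun p : R * R => (Normc.normc (f (plane p)))%:E).

End Plane.

(* Main.v *)
(** Write [eps = n^-gamma]. Summing the eigenvector equation with geometric weights
    shows that in regime (i) every eigenvalue of [J + R] has modulus [< 1/5]; in
    regime (ii) the last row of that equation, where the shift does not act, forces
    modulus [>= 1/4]. A compactly supported [phi] with [Laplacian phi]
    supported in [|z| < 1/4] vanishes for [|z| >= 1/4]: its gradient
    [f = u_x - i u_y] is holomorphic there and the maximum principle for
    [Re (c z^m f)], [m -> oo], kills it. This settles (ii).

    In (i), comparison with the barrier [(1/16 - |z|^2) L / 4], where [L] bounds the
    Laplacian, gives [|phi| <= 9 L / 1600] on [|z| = 1/5], and [phi] is harmonic
    inside. There it is a uniform limit of real parts of polynomials whose [k]-th
    coefficient is at most [2 (9 L / 1600) 5^k], so the difference of the two sums is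
    controlled by [sum_k 5^k |tr (J + R)^k|] and [sum_k 5^k |tr (J + P)^k|]. Entrywise
    comparison with [J + eps * ones] bounds both by [n s / (1 - s)], where
    [s = (25/16) 5^n eps], and the hypothesis on [n] keeps this quantity bounded. *)

Require Import Defs.
From HB Require Import structures.
From mathcomp Require Import all_boot all_order all_algebra.
From mathcomp Require Import complex.
From mathcomp Require cyclic separable cyclotomic.
From mathcomp Require Import all_classical all_reals all_analysis.
From mathcomp Require Import ess_sup_inf.
From mathcomp Require Import ring lra zify.
Import Order.TTheory GRing.Theory Num.Theory.
Import numFieldNormedType.Exports.

Set Implicit Arguments.
Unset Strict Implicit.
Unset Printing Implicit Defensive.

Local Open Scope classical_set_scope.
Local Open Scope ring_scope.
Local Open Scope complex_scope.

(** * Complex moduli and traces of powers *)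

(** In (i) the eigenvalues of [J + R] and [J + P] are not matched one by one; only symmetric
    functions of them are compared. Power sums are the suitable ones: they are traces of powers,
    hence controlled entrywise, and they are all that a polynomial test function sees. Polynomials
    may replace the test function because both spectra lie in the disk where it is harmonic. The
    weight 5^k in the trace sums is forced by the radius 1/5 of that disk, and the terms of degree 0
    cancel because both matrices have n eigenvalues.

    Constants: with delta = 5^n eps, the hypotheses of (i) give delta <= 1/3 and n delta <= 20,
    hence s <= 25/48 and n s / (1 - s) < 66. The barrier at |z| = 1/5 is B = (1/16 - 1/25) L / 4 = 9
    L / 1600. Coefficients of size 2 B 5^k against two trace sums give at most 4 B 66 < 3 L / 2.
    Real and imaginary parts are treated separately, which doubles this to 3 L. *)

Section Normc.
Variable K : realType.
Implicit Types (x y : K[i]).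

Local Notation normc := Normc.normc.

Lemma normcE x : `|x| = (normc x)%:C.
Proof. by []. Qed.

Lemma normc_ge0 x : 0 <= normc x.
Proof. by rewrite -ler0c -normcE normr_ge0. Qed.

Lemma ler_normcD x y : normc (x + y) <= normc x + normc y.
Proof. by rewrite -lecR rmorphD -!normcE ler_normD. Qed.

Lemma normcN x : normc (- x) = normc x.
Proof. by apply: complexI; rewrite -!normcE normrN. Qed.

Lemma normc_real (r : K) : normc r%:C = `|r|.
Proof. by rewrite /= expr0n /= addr0 sqrtr_sqr. Qed.

Lemma normcX x k : normc (x ^+ k) = normc x ^+ k.
Proof.
by elim: k => [|k IH]; rewrite ?expr0 ?exprS ?Normc.normc1// Normc.normcM IH.
Qed.

Lemma ler_normc_sum (I : Type) (r : seq I) (P : pred I) (F : I -> K[i]) :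
  normc (\sum_(i <- r | P i) F i) <= \sum_(i <- r | P i) normc (F i).
Proof.
elim/big_ind2: _ => // [|x1 x2 y1 y2 h1 h2]; first by rewrite Normc.normc0.
exact: le_trans (ler_normcD _ _) (lerD h1 h2).
Qed.

Lemma ler_Re_normc x : complex.Re x <= normc x.
Proof.
case: x => a b /=; apply: le_trans (ler_norm a) _.
by rewrite -sqrtr_sqr ler_wsqrtr// lerDl sqr_ge0.
Qed.

Lemma ler_normRe_normc x : `|complex.Re x| <= normc x.
Proof.
case: x => a b /=; rewrite -sqrtr_sqr ler_wsqrtr// lerDl sqr_ge0//.
Qed.

Lemma ler_normIm_normc x : `|complex.Im x| <= normc x.
Proof. by case: x => a b /=; rewrite -sqrtr_sqr ler_wsqrtr// lerDr sqr_ge0. Qed.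

Lemma normc_le_ReIm x : normc x <= `|complex.Re x| + `|complex.Im x|.
Proof.
case: x => a b /=; rewrite -[leRHS]ger0_norm ?addr_ge0// -sqrtr_sqr.
rewrite ler_wsqrtr// sqrrD !real_normK ?num_real// addrAC lerDl.
by rewrite mulrn_wge0// mulr_ge0.
Qed.

End Normc.

Section TracePowers.
Variable C : numClosedFieldType.

Lemma is_trig_mxX n (T : 'M[C]_n) k : is_trig_mx T ->
  is_trig_mx (T ^+ k) /\ forall i, (T ^+ k) i i = T i i ^+ k.
Proof.
move=> /is_trig_mxP trT; elim: k => [|k [/is_trig_mxP trk diagk]].
  split=> [|i]; last by rewrite !expr0 mxE eqxx.
  apply/is_trig_mxP => i j ij.
  by rewrite expr0 mxE (ltn_eqF ij : i == j = false).
split.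
  apply/is_trig_mxP => i j ij; rewrite exprS mxE big1// => l _.
  have [il|li] := ltnP i l; first by rewrite trT ?mul0r.
  by rewrite trk ?mulr0//; exact: leq_ltn_trans li ij.
move=> i; rewrite exprS mxE (bigD1 i)//= diagk big1 ?addr0 ?exprS// => l li.
have [il|il|/val_inj il] := ltngtP i l; first by rewrite trT ?mul0r.
  by rewrite trk ?mulr0.
by rewrite il eqxx in li.
Qed.

Lemma eigenvaluesE n (M : 'M[C]_n) :
  char_poly M = \prod_(z <- eigenvalues M) ('X - z%:P).
Proof.
rewrite /eigenvalues; case: closed_field_poly_normal => s /= defM.
by rewrite defM (monicP (char_poly_monic M)) scale1r.
Qed.

Lemma size_eigenvalues n (M : 'M[C]_n) : size (eigenvalues M) = n.
Proof.
have := size_char_poly M; rewrite eigenvaluesE size_prod_XsubC.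
by case.
Qed.

Lemma eigenvalue_nth n (M : 'M[C]_n) (i : 'I_n) :
  eigenvalue M (eigenvalues M)`_i.
Proof.
rewrite eigenvalue_root_char eigenvaluesE root_prod_XsubC mem_nth//.
by rewrite size_eigenvalues.
Qed.

(** Schur triangularization: the trace of a power of a triangular matrix is the power sum of its
    diagonal, and that diagonal is a permutation of the eigenvalue list because both factor the same
    characteristic polynomial. *)
Lemma sum_eigenvaluesX n (M : 'M[C]_n) k :
  \sum_(i < n) (eigenvalues M)`_i ^+ k = \tr (M ^+ k).
Proof.
move: M; have [->|n_gt0] := posnP n => M.
  by rewrite /mxtrace !big_ord0.
have [P /unitarymx_unit uP] := Schur M n_gt0.
move=> trPM; have {trPM}: is_trig_mx (conjmx P M) := trPM.
rewrite conjumx//; set T := P *m M *m invmx P; move=> trT.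
have PM : P *m M = T *m P by rewrite /T mulmxKV.
have PMk : P *m (M ^+ k) = (T ^+ k) *m P.
  elim: k => [|k IH]; first by rewrite !expr0 mulmx1 mul1mx.
  by rewrite !exprS -mulmxE mulmxA PM -mulmxA IH mulmxA.
have -> : \tr (M ^+ k) = \tr (T ^+ k).
  by rewrite -[M ^+ k](mulKmx uP) PMk mxtrace_mulC mulmxK.
(* Similarity invariance, obtained by cancelling the nonzero constant polynomial det P from det P *
   char_poly M = char_poly T * det P. *)
have charMT : char_poly M = char_poly T.
  apply: (@mulfI _ (\det P)%:P); first by rewrite polyC_eq0 -unitfE -unitmxE.
  have mapP : (\det P)%:P = \det (map_mx (@polyC C) P).
    by rewrite det_map_mx.
  rewrite [RHS]mulrC mapP /char_poly -!det_mulmx.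
  rewrite /char_poly_mx mulmxBr mulmxBl -!map_mxM/= PM.
  by rewrite scalar_mxC.
have perm : perm_eq (eigenvalues M) [seq T i i | i <- enum 'I_n].
  apply: prod_XsubC_eq; rewrite -eigenvaluesE charMT char_poly_trig//.
  by rewrite big_map big_enum.
have -> : \sum_(i < n) (eigenvalues M)`_i ^+ k =
          \sum_(z <- eigenvalues M) z ^+ k.
  by rewrite (big_nth 0) size_eigenvalues big_mkord.
rewrite (perm_big _ perm) big_map big_enum /=.
by apply: eq_bigr => i _; have [_ ->] := is_trig_mxX k trT.
Qed.

End TracePowers.
(** * Perturbations of the shift matrix *)

Section Shift.
Variables (V : zmodType) (n : nat).
Implicit Types (f : 'I_n -> V).

(** Extension by zero past the last index: the shift then acts as i |-> i + 1 in every row, the last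
    row included, where it produces 0. *)
Definition zero_ext f (i : nat) : V := oapp f 0 (insub i).

Lemma zero_extE f (i : 'I_n) : zero_ext f i = f i.
Proof. by rewrite /zero_ext valK. Qed.

Lemma zero_ext_out f i : (n <= i)%N -> zero_ext f i = 0.
Proof. by move=> ni; rewrite /zero_ext insubF// ltnNge ni. Qed.

End Shift.

Lemma summation_shift (C : pzRingType) n (f : 'I_n -> C) (c : nat -> C) :
  \sum_(i < n) c i.+1 * zero_ext f i.+1 + c 0%N * zero_ext f 0 =
  \sum_(i < n) c i * f i.
Proof.
case: n f => [|n] f; first by rewrite !big_ord0 zero_ext_out// mulr0 addr0.
rewrite big_ord_recr/= zero_ext_out// mulr0 addr0 addrC big_ord_recl.
rewrite (zero_extE f ord0); congr (_ + _).
by apply: eq_bigr => i _; rewrite (zero_extE f (lift ord0 i)).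
Qed.

Lemma mul_superdiag_mx (C : pzRingType) n p (A : 'M[C]_(n, p)) i j :
  (superdiag_mx C n *m A) i j = zero_ext (A^~ j) i.+1.
Proof.
rewrite mxE; have [lt_in|le_ni] := ltnP i.+1 n; last first.
  rewrite zero_ext_out// big1// => l _.
  by rewrite mxE (ltn_eqF (leq_trans (ltn_ord l) le_ni)) mul0r.
rewrite (zero_extE _ (Ordinal lt_in)) (bigD1 (Ordinal lt_in))//= mxE eqxx mul1r.
rewrite big1 ?addr0// => l nl; rewrite mxE.
by move: nl; rewrite -val_eqE => /negPf/= ->; rewrite mul0r.
Qed.

Lemma superdiag_mxX (C : pzRingType) n k (i j : 'I_n) :
  (superdiag_mx C n ^+ k) i j = (j == i + k :> nat)%N%:R.
Proof.
elim: k i => [|k IH] i; first by rewrite expr0 mxE addn0 eq_sym.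
rewrite exprS -mulmxE mul_superdiag_mx.
have [lt_in|le_ni] := ltnP i.+1 n.
  by rewrite (zero_extE _ (Ordinal lt_in)) IH /= addSnnS.
rewrite zero_ext_out// ltn_eqF//; apply: leq_trans (ltn_ord j) _.
by rewrite (leq_trans le_ni)// -addSnnS leq_addr.
Qed.

Lemma sum_pow5_le (K : realFieldType) n : \sum_(i < n) 5 ^+ i <= 5 ^+ n / 4 :> K.
Proof.
elim: n => [|n IH]; first by rewrite big_ord0 expr0; lra.
by rewrite big_ord_recr/= exprS; lra.
Qed.

Section BackwardRecursion.
Variables (K : realFieldType) (n : nat) (y e : 'I_n -> K) (t : K).
Hypothesis t_ge0 : 0 <= t.
Hypothesis y_rec : forall i, y i / 5 <= e i + zero_ext y i.+1 + t.

(** Row i is multiplied by [c i.+1] and the rows are added; re-indexing turns the terms in y_(i+1)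
    into [c i * y i], with no boundary term since [c 0] vanishes. A choice of weights then decides
    which combination of the y_i is estimated. *)
Lemma weighted_recursion (c : nat -> K) : c 0%N = 0 -> (forall i, 0 <= c i) ->
  \sum_(i < n) (c i.+1 / 5 - c i) * y i <=
  \sum_(i < n) c i.+1 * e i + t * \sum_(i < n) c i.+1.
Proof.
move=> c0 c_ge0; under eq_bigr do rewrite mulrBl.
rewrite sumrB -summation_shift c0 mul0r addr0 -sumrB mulr_sumr -big_split/=.
apply: ler_sum => i _; have := ler_wpM2l (c_ge0 i.+1) (y_rec i); lra.
Qed.

(** The weights make every coefficient [c i.+1 / 5 - c i] equal to 1/5, so the total mass appears.
    The constant 25/16 = 5 * (5/4) * (1/4), from the final factor 5, the bound c_(i+1) <= (5/4) 5^i
    and the geometric sum, is the origin of the factor in [s]. *)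
Lemma recursion_sum_le : (forall i, 0 <= e i) ->
  \sum_i y i <= \sum_(i < n) 5 ^+ i * (25 / 4) * e i + t * (25 / 16) * 5 ^+ n.
Proof.
move=> e_ge0.
(* These weights solve [c i.+1 = 5 * c i + 1] with [c 0 = 0]. *)
pose c i : K := (5 ^+ i - 1) / 4.
have c_ge0 i : 0 <= c i by rewrite divr_ge0// subr_ge0 exprn_ege1 ?ler1n.
have c0 : c 0%N = 0 by rewrite /c expr0 subrr mul0r.
have := weighted_recursion c0 c_ge0.
have -> : \sum_(i < n) (c i.+1 / 5 - c i) * y i = (\sum_i y i) / 5.
  rewrite mulr_suml; apply: eq_bigr => i _.
  by rewrite /c exprS; field.
have : \sum_(i < n) c i.+1 * e i <= \sum_(i < n) 5 ^+ i * (5 / 4) * e i.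
  apply: ler_sum => i _; rewrite ler_wpM2r// /c exprS; lra.
have -> : \sum_(i < n) 5 ^+ i * (25 / 4) * e i =
          5 * \sum_(i < n) 5 ^+ i * (5 / 4) * e i.
  by rewrite mulr_sumr; apply: eq_bigr => i _; field.
have : t * \sum_(i < n) c i.+1 <= t * (5 / 4 * (5 ^+ n / 4)).
  rewrite ler_wpM2l//; apply: (@le_trans _ _ (\sum_(i < n) 5 / 4 * 5 ^+ i)).
    by apply: ler_sum => i _; rewrite /c exprS; lra.
  by rewrite -mulr_sumr ler_wpM2l ?sum_pow5_le//; lra.
set A := \sum_(i < n) c i.+1 * e i; lra.
Qed.

(** The weights 5^(i-1-j), started at i = j + 1, satisfy [c i.+1 / 5 = c i] except at i = j, where
    the difference is 1/5; they isolate the single unknown [y j]. *)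
Lemma recursion_diag_le j : (forall i, e i = (i == j)%:R / 5) ->
  y j <= 1 + t * (5 / 4) * 5 ^+ n / 5 ^+ j.
Proof.
move=> eE; pose c i : K := (j < i)%N%:R * 5 ^+ i.-1 / 5 ^+ j.
have p5 k : 0 < 5 ^+ k :> K by rewrite exprn_gt0.
have c_ge0 i : 0 <= c i by rewrite divr_ge0// ?mulr_ge0// ltW.
have c0 : c 0%N = 0 by rewrite /c ltn0 !mul0r.
have := weighted_recursion c0 c_ge0.
have -> : \sum_(i < n) (c i.+1 / 5 - c i) * y i = y j / 5.
  rewrite (bigD1 j)//= big1 ?addr0 => [|i nij].
    by rewrite /c ltnn ltnS leqnn/=; field; rewrite gt_eqF.
  rewrite /c ltnS; have [ji|ij|/val_inj ij] := ltngtP j i; last first.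
  - by rewrite ij eqxx in nij.
  - by rewrite mulr0n !mul0r subrr mul0r.
  - case: (i : nat) ji => // k _; rewrite exprS/=.
    rewrite [X in X * _](_ : _ = 0) ?mul0r//; field.
    by rewrite gt_eqF.
have -> : \sum_(i < n) c i.+1 * e i = 1 / 5.
  rewrite (bigD1 j)//= big1 ?addr0 => [|i nij].
    by rewrite eE eqxx /c ltnS leqnn/=; field; rewrite gt_eqF.
  by rewrite eE (negPf nij) mulr0n mul0r mulr0.
have : t * \sum_(i < n) c i.+1 <= t * (5 ^+ n / 4 / 5 ^+ j).
  rewrite ler_wpM2l//; apply: (@le_trans _ _ (\sum_(i < n) 5 ^+ i / 5 ^+ j)).
    apply: ler_sum => i _; rewrite /c ler_wpM2r ?invr_ge0 ?(ltW (p5 _))//=.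
    by case: (_ < _)%N; rewrite ?mulr1n ?mulr0n ?mul1r ?mul0r// ltW.
  by rewrite -mulr_suml ler_wpM2r ?sum_pow5_le// invr_ge0 ltW.
have -> : t * (5 / 4) * 5 ^+ n / 5 ^+ j = 5 * (t * (5 ^+ n / 4 / 5 ^+ j)).
  by field; rewrite gt_eqF.
lra.
Qed.

End BackwardRecursion.

Section ComparisonMatrix.
Variables (K : realFieldType) (n : nat) (eps : K).
Hypothesis eps_ge0 : 0 <= eps.

Let s := 25 / 16 * (5 ^+ n * eps).
Hypothesis s_lt1 : s < 1.

Definition comparison_mx : 'M[K]_n := superdiag_mx K n + const_mx eps.

Lemma comparison_mx_ge0 i j : 0 <= comparison_mx i j.
Proof. by rewrite !mxE addr_ge0. Qed.

Lemma comparison_mxX_ge0 k i j : 0 <= (comparison_mx ^+ k) i j.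
Proof.
elim: k i j => [|k IH] i j; first by rewrite expr0 mxE ler0n.
by rewrite exprS mxE sumr_ge0// => l _; rewrite mulr_ge0 ?comparison_mx_ge0.
Qed.

(** Column j of the truncated Neumann series satisfies the scalar recursion with source 1/5 at j and
    t = eps times its own column sum. The recursion is used twice: with the mass weights to bound
    the column sum, then with the weights started at j to bound the diagonal entry. The factor 5^j
    of the first bound cancels against 5^(-j) in the second, so the result is uniform in j and in
    N. *)
Lemma comparison_trace_le N :
  \sum_(k < N.+1) 5 ^+ k * \tr (comparison_mx ^+ k) <= n%:R * (1 + s / (1 - s)).
Proof.
set S : 'M[K]_n := \sum_(k < N.+1) 5 ^+ k *: comparison_mx ^+ k.
have SE i j : S i j = \sum_(k < N.+1) 5 ^+ k * (comparison_mx ^+ k) i j.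
  by rewrite summxE; apply: eq_bigr => k _; rewrite mxE.
have S_ge0 i j : 0 <= S i j.
  rewrite SE sumr_ge0// => k _.
  by rewrite mulr_ge0 ?comparison_mxX_ge0// exprn_ge0.
(* [S] is a truncated Neumann series, so that [S <= 1 + 5 N S] entrywise. *)
have S_le i j : S i j <= (i == j)%:R + 5 * (comparison_mx *m S) i j.
  have -> : comparison_mx *m S =
            \sum_(k < N.+1) 5 ^+ k *: comparison_mx ^+ k.+1.
    by rewrite mulmx_sumr; apply: eq_bigr => k _; rewrite -scalemxAr exprS.
  rewrite SE big_ord_recl !expr0 mul1r mxE lerD2l summxE big_ord_recr/=.
  rewrite mulrDr mulr_sumr mxE ler_wpDr//.
    by rewrite mulr_ge0// mulr_ge0 ?exprn_ge0// comparison_mxX_ge0.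
  by apply: ler_sum => k _; rewrite mxE mulrA -exprS.
have diag_le j : S j j <= 1 + s / (1 - s).
  pose y (i : 'I_n) : K := S i j; pose sg := \sum_i y i.
  have sg_ge0 : 0 <= sg by apply: sumr_ge0 => i _; exact: S_ge0.
  have t_ge0 : 0 <= eps * sg by rewrite mulr_ge0.
  pose e (i : 'I_n) : K := (i == j)%:R / 5.
  have y_rec i : y i / 5 <= e i + zero_ext y i.+1 + eps * sg.
    have := S_le i j.
    rewrite mulmxDl mxE mul_superdiag_mx -/y.
    rewrite [X in _ * (_ + X)](_ : _ = eps * sg).
      rewrite /e -/(y i); set z := zero_ext _ _; lra.
    by rewrite mxE mulr_sumr; apply: eq_bigr => l _; rewrite mxE.
  have := recursion_sum_le t_ge0 y_rec (fun i => divr_ge0 (ler0n _ _) (ler0n _ _)).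
  rewrite -/sg (bigD1 j)//= big1 ?addr0; last first.
    by move=> i nij; rewrite /e (negPf nij) mulr0n mul0r mulr0.
  rewrite /e eqxx mulr1n.
  have -> : eps * sg * (25 / 16) * 5 ^+ n = s * sg by rewrite /s; ring.
  move=> sg_le.
  (* The column sum occurs on both sides, with factor s on the right; it is absorbed because s <
     1. *)
  have {sg_le} sg_le : sg <= 5 / 4 * 5 ^+ j / (1 - s).
    by rewrite ler_pdivlMr ?subr_gt0//; lra.
  have := recursion_diag_le t_ge0 y_rec (fun i => erefl).
  rewrite -/(y j) => /le_trans; apply; rewrite lerD2l.
  have p5 : 0 < 5 ^+ j :> K by rewrite exprn_gt0.
  have -> : s / (1 - s) =
      eps * (5 / 4 * 5 ^+ j / (1 - s)) * (5 / 4) * 5 ^+ n / 5 ^+ j.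
    by rewrite /s; field; rewrite !gt_eqF// subr_gt0 -/s;
      move: s_lt1; rewrite /s; lra.
  by rewrite !ler_wpM2r ?invr_ge0 ?exprn_ge0// ler_wpM2l.
have -> : \sum_(k < N.+1) 5 ^+ k * \tr (comparison_mx ^+ k) = \tr S.
  by rewrite raddf_sum; apply: eq_bigr => k _; rewrite /= mxtraceZ.
apply: (@le_trans _ _ (\sum_(j < n) (1 + s / (1 - s)))).
  by apply: ler_sum => j _.
by rewrite sumr_const card_ord -[X in X <= _]mulr_natl.
Qed.

End ComparisonMatrix.
(** * Numerical estimates *)

Section Numerics.
Variable K : realType.
Implicit Types (g x : K) (n k : nat).

Lemma ler_ln_gt0 (a b : K) : 0 < a -> a <= b -> ln a <= ln b.
Proof.
by move=> a0 ab; rewrite ler_ln// posrE//; exact: lt_le_trans ab.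
Qed.

Lemma ln5_gt0 : 0 < ln 5 :> K. Proof. by rewrite ln_gt0// ltr1n. Qed.
Lemma ln3_gt0 : 0 < ln 3 :> K. Proof. by rewrite ln_gt0// ltr1n. Qed.

(** From 1 - 1/8 <= exp(-1/8) one gets exp(1/8) <= 8/7, and (8/7)^8 is about 2.91. *)
Lemma expR1_lt3 : expR 1 < 3 :> K.
Proof.
have h : expR (8^-1) <= 8 / 7 :> K.
  have := expR_ge1Dx (- 8^-1 : K); rewrite expRN => h.
  have e0 := expR_gt0 (8^-1 : K).
  have : (1 + - 8^-1) * expR 8^-1 <= 1 :> K.
    by rewrite -ler_pdivlMr// div1r.
  lra.
have -> : 1 = 8%:R * 8^-1 :> K by rewrite mulfV.
rewrite expRM_natl; apply: (@le_lt_trans _ _ ((8 / 7) ^+ 8)).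
  by rewrite lerXn2r// nnegrE ?expR_ge0//; lra.
by lra.
Qed.

Lemma ln5_gt1 : 1 < ln 5 :> K.
Proof.
rewrite -[X in X < _](@expRK K) ltr_ln ?posrE ?expR_gt0//.
by apply: lt_trans expR1_lt3 _; lra.
Qed.

Lemma ln2_ge_half : 1 / 2 <= ln 2 :> K.
Proof.
have : 1 <= 2 * ln 2 :> K.
  rewrite mulr_natl -lnXn//; rewrite -[X in X <= _](@expRK K).
  by apply: ler_ln_gt0; rewrite ?expR_gt0// (le_trans (ltW expR1_lt3))//; lra.
lra.
Qed.

Lemma ler_ln_subr1 x : 0 < x -> ln x <= x - 1.
Proof. by move=> x0; have := @le_ln1Dx K (x - 1); rewrite subrKC; apply; lra. Qed.

Lemma ln_le_half x : 0 < x -> ln x <= x / 2.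
Proof.
move=> x0; have := @ler_ln_subr1 (x / 2) (divr_gt0 x0 (ltr0Sn _ 1)).
rewrite ln_div ?posrE// => h.
have : ln 2 <= 1 :> K by have := @ler_ln_subr1 2 (ltr0Sn _ 1); lra.
lra.
Qed.

Section RegimeSmall.
Variables (n : nat) (g : K).
Hypotheses (g_gt0 : 0 < g) (n_ge7 : (7 <= n)%N).
Hypothesis n_le : n%:R <= (g * ln g - ln 3) / ln 5.

Let n_gt0 : 0 < n%:R :> K. Proof. by rewrite ltr0n (leq_trans _ n_ge7). Qed.
Let n_ge7K : 7 <= n%:R :> K. Proof. by rewrite ler_nat. Qed.

Let gln : n%:R * ln 5 + ln 3 <= g * ln g.
Proof. by move: n_le; rewrite ler_pdivlMr ?ln5_gt0//; lra. Qed.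

(** Logarithmic form of 5^n n^(-g) <= 1/3. For g <= n it is the hypothesis and monotonicity of the
    logarithm. For g > n, the bound n >= 7 yields n (ln 7 - ln 5) >= 7 ln (7/5) >= ln 3, as (7/5)^7
    > 3. *)
Lemma ln_delta_le : n%:R * ln 5 + ln 3 <= g * ln n%:R.
Proof.
have [gn|ng] := lerP g n%:R.
  by apply: le_trans gln _; rewrite ler_wpM2l ?(ltW g_gt0)// ler_ln_gt0.
apply: (@le_trans _ _ (n%:R * ln n%:R)); last first.
  by rewrite ler_wpM2r ?(ltW ng)// ln_ge0// (le_trans _ n_ge7K)//; lra.
apply: (@le_trans _ _ (n%:R * ln 7)); last first.
  by rewrite ler_wpM2l ?(ltW n_gt0)// ler_ln_gt0.
rewrite -lerBrDl -mulrBr -ln_div ?posrE//.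
have l75 : 0 < ln (7 / 5) :> K by rewrite ln_gt0//; lra.
apply: (@le_trans _ _ (7 * ln (7 / 5))); last by rewrite ler_wpM2r// ltW.
rewrite mulr_natl -lnXn//; apply: ler_ln_gt0; lra.
Qed.

(** Logarithmic form of n 5^n n^(-g) <= 20; the extra factor n is paid for by the bound 1/3 when n
    is moderate, and by the slack between g ln g and g ln n when n is large. *)
Lemma ln_n_delta_le : n%:R * ln 5 + ln n%:R <= g * ln n%:R + ln 20.
Proof.
(* 60 = 20 * 3: up to this value the factor n is covered by the previous bound. *)
have [n60|n61] := leqP n 60.
  have : ln n%:R <= ln 20 + ln 3 :> K.
    rewrite -lnM ?posrE//; apply: ler_ln_gt0 => //.
    by rewrite -natrM ler_nat.
  have := ln_delta_le; lra.
have n61K : 61 <= n%:R :> K by rewrite ler_nat.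
have ln20 : 0 < ln 20 :> K by rewrite ln_gt0// ltr1n.
(* 5^5 = 3125 <= 3721 = 61^2. *)
have lnn : 5 / 2 * ln 5 <= ln n%:R :> K.
  suff : 5 * ln 5 <= 2 * ln n%:R :> K by lra.
  rewrite !mulr_natl -!lnXn//; apply: ler_ln_gt0; first by rewrite exprn_gt0.
  apply: (@le_trans _ _ (61 ^+ 2)); first by lra.
  by rewrite lerXn2r// nnegrE// ltW.
have l5 := ln5_gt0.
(* If g >= n/2, then g ln n - ln n >= (n/2 - 1) (5/2) ln 5, which exceeds n ln 5 once n >= 10. If g
   < n/2, then g ln n exceeds g ln g by g ln 2 >= g/2, while n <= g^2 and the tangent of ln at 4
   give ln n <= 4 ln 2 + g/2 - 2 with 4 ln 2 <= ln 20. *)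
have [ng|gn] := lerP (n%:R / 2) g.
  have h1 : n%:R / 2 * ln n%:R <= g * ln n%:R by rewrite ler_wpM2r//; lra.
  have h2 : (n%:R / 2 - 1) * (5 / 2 * ln 5) <= (n%:R / 2 - 1) * ln n%:R :> K.
    by rewrite ler_wpM2l//; lra.
  have h3 : 10 * ln 5 <= n%:R * ln 5 :> K by rewrite ler_wpM2r//; lra.
  lra.
have h1 : ln g + ln 2 <= ln n%:R.
  by rewrite -lnM ?posrE//; apply: ler_ln_gt0; rewrite ?mulr_gt0//; lra.
have h2 : g * ln g + g * ln 2 <= g * ln n%:R.
  by rewrite -mulrDr ler_wpM2l// ltW.
have n_le_gg : n%:R <= g ^+ 2.
  have lng : ln g <= g by have := ler_ln_subr1 g_gt0; lra.
  have : g * ln g <= g ^+ 2 by rewrite expr2 ler_wpM2l// ltW.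
  have : n%:R * 1 <= n%:R * ln 5 :> K by rewrite ler_wpM2l// ltW// ln5_gt1.
  by have := ln3_gt0; have := gln; lra.
have h3 : ln n%:R <= 2 * ln g.
  by rewrite mulr_natl -lnXn//; exact: ler_ln_gt0.
have h4 : ln g <= 2 * ln 2 + g / 4 - 1.
  have := @ler_ln_subr1 (g / 4) (divr_gt0 g_gt0 (ltr0Sn _ 3)).
  rewrite ln_div ?posrE// (_ : ln 4 = 2 * ln 2); first by have := gln; lra.
  by rewrite mulr_natl -lnXn//; congr ln; lra.
have h5 : g * (1 / 2) <= g * ln 2 by rewrite ler_wpM2l ?(ltW g_gt0)// ln2_ge_half.
have h6 : 4 * ln 2 <= ln 20 :> K.
  by rewrite mulr_natl -lnXn//; apply: ler_ln_gt0; lra.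
have := ln3_gt0; have := gln; lra.
Qed.

Let deltaE : 5 ^+ n * n%:R `^ (- g) = expR (n%:R * ln 5 - g * ln n%:R).
Proof.
rewrite /powR gt_eqF// expRD mulNr; congr (_ * _).
by rewrite expRM_natl lnK// posrE.
Qed.

Lemma delta_le : 5 ^+ n * n%:R `^ (- g) <= 3^-1.
Proof.
rewrite deltaE -[leRHS](@lnK K) ?posrE ?invr_gt0// ler_expR lnV ?posrE//.
have := ln_delta_le; lra.
Qed.

Lemma n_delta_le : n%:R * (5 ^+ n * n%:R `^ (- g)) <= 20.
Proof.
rewrite deltaE -{1}[n%:R](@lnK K) ?posrE// -expRD.
rewrite -[leRHS](@lnK K) ?posrE// ler_expR.
have := ln_n_delta_le; lra.
Qed.

End RegimeSmall.

Section RegimeLarge.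
Variables (n : nat) (g : K).
Hypotheses (g_ge5 : 5 <= g) (n_ge : 2 * g * ln g <= n%:R).

Lemma n_ge10 : (10 <= n)%N.
Proof.
rewrite -(ler_nat K); apply: le_trans n_ge.
have : 5 * 1 <= g * ln g.
  rewrite ler_pM//; apply: ltW; apply: lt_le_trans ln5_gt1 _.
  exact: ler_ln_gt0.
lra.
Qed.

Let n_ge10K : 10 <= n%:R :> K. Proof. by rewrite ler_nat n_ge10. Qed.
Let n_gt0 : 0 < n%:R :> K. Proof. by have := n_ge10K; lra. Qed.

(** Equivalent to n^(-g) >= exp(-n). If g > n / ln n, then ln g >= ln n - ln (ln n) >= (ln n) / 2,
    so 2 g ln g >= g ln n > n, against the hypothesis on n. *)
Lemma g_ln_n_le : g * ln n%:R <= n%:R.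
Proof.
have lnn : 1 <= ln n%:R :> K.
  apply: ltW; apply: lt_le_trans ln5_gt1 _; apply: ler_ln_gt0 => //.
  by have := n_ge10K; lra.
have lnn0 : 0 < ln n%:R :> K by lra.
rewrite leNgt; apply/negP => ngl.
have ng : n%:R / ln n%:R < g by rewrite ltr_pdivrMr.
have q0 : 0 < n%:R / ln n%:R :> K by rewrite divr_gt0.
have h1 : ln n%:R - ln (ln n%:R) <= ln g.
  by rewrite -ln_div ?posrE//; apply: ler_ln_gt0 => //; exact: ltW.
have := ln_le_half lnn0 => h2.
have h3 : g * (ln n%:R / 2) <= g * ln g by rewrite ler_wpM2l//; lra.
have := n_ge; lra.
Qed.

Lemma n_eps_le : n%:R * n%:R `^ (- g) <= 1 / 1000.
Proof.
rewrite -[X in X * _](@powRr1 _ n%:R) ?(ltW n_gt0)// -powRD; last first.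
  by rewrite (gt_eqF n_gt0) implybT.
apply: (@le_trans _ _ (n%:R `^ (- 3))).
  rewrite ler_powR//; [have := n_ge10K; lra|have := g_ge5; lra].
rewrite powRN (@powR_mulrn _ _ 3); last exact: ltW n_gt0.
rewrite div1r; have n10 := n_ge10K.
have h : 10 ^+ 3 <= n%:R ^+ 3 :> K by rewrite lerXn2r// nnegrE ltW.
have p10 : 0 < 10 ^+ 3 :> K by rewrite exprn_gt0.
have e1000 : 1000 = 10 ^+ 3 :> K by ring.
rewrite e1000 lef_pV2//; rewrite posrE//.
exact: lt_le_trans h.
Qed.

(** 4^(-n) = (3/4)^n 3^(-n), where 3^(-n) <= exp(-n) <= n^(-g), and (3/4)^10 < 1/12 provides the
    constant since n >= 10. *)
Lemma pow4_div_eps_le : 4^-1 ^+ n <= n%:R `^ (- g) / 12.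
Proof.
apply: (@le_trans _ _ (expR (- n%:R) / 12)); last first.
  rewrite ler_wpM2r ?invr_ge0// /powR gt_eqF// ler_expR mulNr lerN2.
  exact: g_ln_n_le.
have -> : expR (- n%:R) = (expR 1)^-1 ^+ n :> K.
  by rewrite expRN exprVn -expRM_natl mulr1.
have -> : 4^-1 ^+ n = (3 / 4) ^+ n * (3^-1 ^+ n) :> K.
  by rewrite -exprMn; congr (_ ^+ n); field.
rewrite mulrC ler_pM ?exprn_ge0 ?invr_ge0//.
  rewrite lerXn2r ?nnegrE ?invr_ge0 ?expR_ge0//.
  by rewrite lef_pV2 ?posrE ?expR_gt0// ltW// expR1_lt3.
apply: (@le_trans _ _ ((3 / 4) ^+ 10)); last by lra.
by apply: ler_wiXn2l; [lra|lra|exact: n_ge10].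
Qed.

End RegimeLarge.

End Numerics.

(** * Location of the eigenvalues of the perturbed shift, and comparison of its powers *)

(** [eigenvalue] speaks of row vectors, whereas the recursion along the superdiagonal is read off a
    column eigenvector; a singular M - a has a kernel on both sides. *)
Lemma eigenvalue_colP (F : fieldType) n (M : 'M[F]_n) a :
  eigenvalue M a -> exists2 x : 'cV_n, M *m x = a *: x & x != 0.
Proof.
move=> eva; have nu : (M - a%:M)^T \notin unitmx.
  rewrite unitmx_tr -row_free_unit -kermx_eq0; exact: eva.
have : kermx (M - a%:M)^T != 0 by rewrite kermx_eq0 row_free_unit.
move=> /rowV0Pn[v /sub_kermxP vM v0]; exists v^T; last by rewrite trmx_eq0.
move/(congr1 trmx): vM; rewrite trmx_mul trmxK trmx0 mulmxBl mul_scalar_mx.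
by move/eqP; rewrite subr_eq0 => /eqP.
Qed.

Lemma perturbed_shift_mul (C : pzRingType) n (R X Y : 'M[C]_n) i j :
  ((superdiag_mx C n + R) * X) i j - (superdiag_mx C n * Y) i j =
  zero_ext (fun l => X l j - Y l j) i.+1 + (R *m X) i j.
Proof.
rewrite -!mulmxE mulmxDl mxE !mul_superdiag_mx addrAC; congr (_ + _).
by rewrite /zero_ext; case: insub => //=; rewrite subrr.
Qed.

Section PerturbedShift.
Variables (K : realType) (n : nat) (eps : K) (R : 'M[K[i]]_n).
Hypothesis R_le : forall i j, Normc.normc (R i j) <= eps.

Local Notation normc := Normc.normc.
Local Notation J := (superdiag_mx K[i] n).

Lemma normc_zero_ext (f : 'I_n -> K[i]) i :
  normc (zero_ext f i) = zero_ext (@normc K \o f) i.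
Proof. by rewrite /zero_ext; case: insub => //=; exact: Normc.normc0. Qed.

Lemma entry_eps_ge0 : (0 < n)%N -> 0 <= eps.
Proof.
move=> n_gt0; apply: le_trans (R_le (Ordinal n_gt0) (Ordinal n_gt0)).
exact: normc_ge0.
Qed.

Lemma normc_mul_entries (x : 'cV[K[i]]_n) i :
  normc ((R *m x) i 0) <= eps * \sum_l normc (x l 0).
Proof.
rewrite mxE mulr_sumr; apply: le_trans (ler_normc_sum _ _ _) _.
by apply: ler_sum => l _; rewrite Normc.normcM ler_wpM2r// normc_ge0.
Qed.

Lemma normc_sum_eq0 (x : 'cV[K[i]]_n) : \sum_l normc (x l 0) <= 0 -> x = 0.
Proof.
move=> h; apply/colP => l; rewrite mxE; apply: Normc.eq0_normc; apply/eqP.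
rewrite eq_le normc_ge0 andbT; apply: le_trans h.
by rewrite (bigD1 l)//= lerDl sumr_ge0// => *; exact: normc_ge0.
Qed.

Lemma eigen_recursion (x : 'cV[K[i]]_n) a i : (J + R) *m x = a *: x ->
  a * x i 0 = zero_ext (x^~ 0) i.+1 + (R *m x) i 0.
Proof.
by move/matrixP => /(_ i 0); rewrite mulmxDl mxE mul_superdiag_mx !mxE => ->.
Qed.

Section InnerDisk.
Let s := 25 / 16 * (5 ^+ n * eps).
Hypothesis s_lt1 : s < 1.

(** If |a| >= 1/5, the moduli of the eigenvector entries satisfy the scalar recursion without
    source, so their sum is at most s times itself and the vector vanishes. *)
Lemma eigenvalue_perturbed_lt a : (0 < n)%N ->
  eigenvalue (J + R) a -> normc a < 5^-1.
Proof.
move=> n_gt0 /eigenvalue_colP[x Mx x0]; rewrite ltNge; apply/negP => ra.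
have eps_ge0 := entry_eps_ge0 n_gt0.
pose y i : K := normc (x i 0); pose sg := \sum_i y i.
have sg_ge0 : 0 <= sg by apply: sumr_ge0 => i _; exact: normc_ge0.
have t_ge0 : 0 <= eps * sg by rewrite mulr_ge0.
have y_rec i : y i / 5 <= 0 + zero_ext y i.+1 + eps * sg.
  apply: (@le_trans _ _ (normc a * y i)).
    by rewrite mulrC ler_wpM2r// normc_ge0.
  rewrite /y -Normc.normcM (eigen_recursion _ Mx) add0r.
  apply: le_trans (ler_normcD _ _) _.
  by rewrite normc_zero_ext lerD// normc_mul_entries.
have := recursion_sum_le t_ge0 y_rec (fun=> lexx 0).
rewrite -/sg big1 ?add0r => [|i _]; last by rewrite mulr0.
have -> : eps * sg * (25 / 16) * 5 ^+ n = s * sg by rewrite /s; ring.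
move=> sg_le; move: x0; rewrite (@normc_sum_eq0 x) ?eqxx// -/sg.
have : (1 - s) * sg <= 0 by lra.
by rewrite pmulr_rle0 ?subr_gt0.
Qed.

(** Induction along (J + R) X - J Y = J (X - Y) + R X, carried out in parallel for the perturbed
    matrix and for the comparison matrix. What is compared is the sum of the words in J and R that
    contain at least one factor R. *)
Lemma normc_powers_sub_le k i j :
  normc (((J + R) ^+ k) i j - (J ^+ k) i j) <=
  (comparison_mx n eps ^+ k) i j - (superdiag_mx K n ^+ k) i j.
Proof.
elim: k i j => [|k IH] i j.
  by rewrite !expr0 !mxE !subrr Normc.normc0.
rewrite (exprS (J + R)) (exprS J) (exprS (comparison_mx n eps)).
rewrite (exprS (superdiag_mx K n)) (perturbed_shift_mul R).
rewrite (perturbed_shift_mul (const_mx eps)).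
apply: le_trans (ler_normcD _ _) (lerD _ _).
  rewrite normc_zero_ext /zero_ext; case: insub => //= l; exact: IH.
rewrite !mxE; apply: le_trans (ler_normc_sum _ _ _) _.
apply: ler_sum => l _; rewrite Normc.normcM mxE.
rewrite ler_pM ?normc_ge0//.
(* The factor next to R is the full power. Its bound follows from the induction hypothesis because
   the entries of J^k are 0 or 1, so that restoring J^k costs the same on both sides. *)
have -> : ((J + R) ^+ k) l j =
  (((J + R) ^+ k) l j - (J ^+ k) l j) + (J ^+ k) l j by rewrite subrK.
apply: le_trans (ler_normcD _ _) _; rewrite -lerBrDr.
apply: le_trans (IH l j) _; rewrite lerD2l lerN2 !superdiag_mxX.
by case: (_ == _); rewrite ?Normc.normc0 ?Normc.normc1.
Qed.

(** Positive powers of J have zero diagonal, so the entrywise comparison bounds the traces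
    themselves. The power 0 contributes exactly n to the comparison bound and is removed from both
    sides. *)
Lemma sum_trace_powers_le N : (0 < n)%N ->
  \sum_(k < N) 5 ^+ k.+1 * normc (\tr ((J + R) ^+ k.+1)) <=
  n%:R * (s / (1 - s)).
Proof.
move=> n_gt0; have eps_ge0 := entry_eps_ge0 n_gt0.
have := comparison_trace_le eps_ge0 s_lt1 N.
rewrite big_ord_recl !expr0 mul1r mxtrace1 mulrDr mulr1 lerD2l.
apply: le_trans; apply: ler_sum => k _ /=; rewrite ler_wpM2l ?exprn_ge0//.
apply: le_trans (ler_normc_sum _ _ _) _; apply: ler_sum => i _.
have diag0 (C : pzRingType) : (superdiag_mx C n ^+ k.+1) i i = 0.
  by rewrite superdiag_mxX -{1}[i : nat]addn0 eqn_add2l.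
move: (normc_powers_sub_le k.+1 i i).
move: ((J + R) ^+ k.+1) (comparison_mx n eps ^+ k.+1) => X Y.
by rewrite (diag0 K[i]) (diag0 K) !subr0.
Qed.

End InnerDisk.

(* For a small eigenvalue the eigenvector decays away from its first entry, which
   then dominates the last row of [R *m x]; this contradicts the smallness of
   [a * x_(n-1)]. *)
Lemma eigenvalue_perturbed_ge a : (0 < n)%N -> 0 < eps ->
  (forall i j, normc (R i j) = eps) ->
  n%:R * eps <= 1 / 1000 -> 4^-1 ^+ n <= eps / 12 ->
  eigenvalue (J + R) a -> 4^-1 <= normc a.
Proof.
move=> n_gt0 eps_gt0 R_eq n_eps pow4 /eigenvalue_colP[x Mx x0].
rewrite leNgt; apply/negP => ra.
pose y i : K := normc (x i 0); pose sg := \sum_i y i.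
have sg_ge0 : 0 <= sg by apply: sumr_ge0 => i _; exact: normc_ge0.
have sg_gt0 : 0 < sg.
  rewrite lt_def sg_ge0 andbT; apply: contra x0 => /eqP sg0.
  by rewrite (@normc_sum_eq0 x)// -/sg sg0.
have y_ge0 i : 0 <= y i := normc_ge0 _.
have t_ge0 : 0 <= eps * sg by rewrite mulr_ge0// ltW.
have y_rec (i : 'I_n) : zero_ext y i.+1 <= 4^-1 * y i + eps * sg.
  have -> : zero_ext y i.+1 = normc (a * x i 0 - (R *m x) i 0).
    by rewrite (eigen_recursion _ Mx) addrK normc_zero_ext.
  apply: le_trans (ler_normcD _ _) _; rewrite normcN Normc.normcM.
  by rewrite lerD ?normc_mul_entries// ler_wpM2r ?normc_ge0// ltW.
pose i0 := Ordinal n_gt0; pose y0 := y i0.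
have y_le (i : 'I_n) : y i <= 4^-1 ^+ i * y0 + 4 / 3 * (eps * sg).
  case: i => i; elim: i => [|i IH] lt_in.
    rewrite expr0 mul1r /y0 (_ : Ordinal lt_in = i0); last exact: val_inj.
    by rewrite lerDl; lra.
  have lt_in' := ltnW lt_in.
  have := y_rec (Ordinal lt_in'); rewrite (zero_extE _ (Ordinal lt_in)).
  by have := IH lt_in'; rewrite exprS/=; lra.
have pow_sum m : \sum_(i < m) 4^-1 ^+ i <= 4 / 3 - 4 / 3 * 4^-1 ^+ m :> K.
  elim: m => [|m IH]; first by rewrite big_ord0 expr0; lra.
  have : 0 <= 4^-1 ^+ m :> K by rewrite exprn_ge0.
  by rewrite big_ord_recr/= exprS; lra.
(* Summing the geometric decay gives sg <= (4/3) y0 + (4/3) n eps sg, where n eps <= 1/1000: the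
   first entry carries almost three quarters of the mass. *)
have y0_ge : (3 / 4 - 1 / 1000) * sg <= y0.
  have h : sg <= 4 / 3 * y0 + n%:R * eps * (4 / 3) * sg.
    apply: (@le_trans _ _
      (\sum_(i < n) (4^-1 ^+ i * y0 + 4 / 3 * (eps * sg)))).
      by apply: ler_sum => i _.
    rewrite big_split/= -mulr_suml sumr_const card_ord -[X in _ + X]mulr_natl.
    apply: lerD; last by rewrite le_eqVlt; apply/orP; left; apply/eqP; ring.
    rewrite ler_wpM2r ?y_ge0//; apply: le_trans (pow_sum n) _.
    by rewrite gerBl mulr_ge0 ?exprn_ge0.
  have : n%:R * eps * sg <= 1 / 1000 * sg by rewrite ler_wpM2r.
  lra.
have lt_last : (n.-1 < n)%N by rewrite prednK.
pose il := Ordinal lt_last.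
have last_eq : a * x il 0 = (R *m x) il 0.
  by rewrite (eigen_recursion _ Mx) /= zero_ext_out ?add0r// prednK.
(* Every entry of R has modulus exactly eps, so the first term has modulus eps y0 and the remaining
   ones together at most eps (sg - y0). *)
have row_ge : eps * (2 * y0 - sg) <= normc ((R *m x) il 0).
  rewrite mxE (bigD1 i0)//=; set T := \sum_(_ | _) _.
  have T_le : normc T <= eps * (sg - y0).
    apply: le_trans (ler_normc_sum _ _ _) _.
    have -> : sg - y0 = \sum_(l | l != i0) y l.
      by rewrite /sg (bigD1 i0)//= addrAC subrr add0r.
    rewrite mulr_sumr.
    by apply: ler_sum => l _; rewrite Normc.normcM R_eq.
  have : normc (R il i0 * x i0 0) = eps * y0 by rewrite Normc.normcM R_eq.
  have := ler_normcD (R il i0 * x i0 0 + T) (- T); rewrite addrK normcN.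
  lra.
have last_le : normc (a * x il 0) <= 4^-1 ^+ n * sg + eps * sg / 3.
  rewrite Normc.normcM; apply: (@le_trans _ _ (4^-1 * y il)).
    by rewrite ler_wpM2r ?(y_ge0 il)// ltW.
  have : 4^-1 ^+ n * y0 <= 4^-1 ^+ n * sg.
    rewrite ler_wpM2l ?exprn_ge0// /sg (bigD1 i0)//= lerDl.
    by apply: sumr_ge0 => l _; exact: y_ge0.
  have := y_le il; rewrite /= -[X in 4^-1 ^+ X * y0 <= _ -> _](prednK n_gt0).
  by rewrite exprS; lra.
(* The contradiction in units of eps sg: the last row is at least 2 (3/4 - 1/1000) - 1 = 0.498 and
   at most 1/12 + 1/3 < 0.42. *)
have := ler_wpM2r sg_ge0 pow4.
have : 0 < eps * sg by rewrite mulr_gt0.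
have := ler_wpM2l (ltW eps_gt0) y0_ge.
move: row_ge last_le; rewrite last_eq; lra.
Qed.

End PerturbedShift.
(** * The maximum principle in the plane *)

Section DirectionalDerivatives.
Variable K : realType.
Implicit Types (p q v : K * K) (w : K * K -> K) (U D : set (K * K)).

Local Notation e1 := ((1, 0) : K * K).
Local Notation e2 := ((0, 1) : K * K).

Lemma is_derive_line w v p d (t : K) : is_derive (t *: v + p) v w d ->
  is_derive t 1 (fun s : K => w (s *: v + p)) d.
Proof.
move=> [dw vd].
have E : (fun h : K => h^-1 *: (w (h *: v + (t *: v + p)) - w (t *: v + p))) =
         (fun h : K => h^-1 *: (w ((h *: (1 : K) + t) *: v + p) - w (t *: v + p))).
  by apply/funext => h; rewrite -[h *: (1 : K)]/(h * 1) mulr1 scalerDl addrA.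
split; first by move: dw; rewrite /derivable E.
by rewrite -vd /derive E.
Qed.

Lemma is_derive_fst p v : is_derive p v (fst : K * K -> K) v.1.
Proof.
have E : (fun h : K => h^-1 *: ((h *: v + p).1 - p.1)) @ 0^' --> v.1.
  apply: cvg_near_cst; near=> h.
  have h0 : h != 0 by near: h; exact: nbhs_dnbhs_neq.
  by rewrite /= addrK scalerA mulVf// scale1r.
by split; [apply/cvg_ex; exists v.1|exact/cvg_lim].
Unshelve. all: by end_near. Qed.

Lemma is_derive_snd p v : is_derive p v (snd : K * K -> K) v.2.
Proof.
have E : (fun h : K => h^-1 *: ((h *: v + p).2 - p.2)) @ 0^' --> v.2.
  apply: cvg_near_cst; near=> h.
  have h0 : h != 0 by near: h; exact: nbhs_dnbhs_neq.
  by rewrite /= addrK scalerA mulVf// scale1r.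
by split; [apply/cvg_ex; exists v.2|exact/cvg_lim].
Unshelve. all: by end_near. Qed.

(** At the maximum g' vanishes. If d were positive, g'(h) / h would be positive for small h, so g' >
    0 just to the right of 0, and the mean value theorem would make g exceed g(0) there. *)
Lemma second_derivative_at_max (g g' : K -> K) (d e : K) : 0 < e ->
  (forall t : K, `|t| < e -> is_derive t 1 g (g' t)) ->
  is_derive (0 : K) 1 g' d -> (forall t : K, `|t| < e -> g t <= g 0) -> d <= 0.
Proof.
move=> e0 dg [dg' g'd] gmax; rewrite leNgt; apply/negP => d0.
have lte (t : K) : t \in `](- e), e[%R -> `|t| < e.
  by rewrite in_itv/= => /andP[? ?]; rewrite ltr_norml; apply/andP.
have g'0 : g' 0 = 0.
  have d0' : is_derive (0 : K) 1 g 0.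
    have ee : - e <= e by rewrite ge0_cp// ltW.
  have e_in : (0 : K) \in `](- e), e[%R by rewrite in_itv/= oppr_lt0 e0.
  apply: (derive1_at_max ee _ e_in) => t /lte; last exact: gmax.
  by case/dg.
  by have [_ <-] := dg 0 (eq_ind_r (fun z => z < e) e0 (normr0 _)); case: d0'.
have lim : (fun h : K => h^-1 * g' h) @ 0^' --> d.
  have -> : (fun h : K => h^-1 * g' h) =
            (fun h : K => h^-1 *: (g' (h *: 1 + 0) - g' 0)).
    by apply/funext => h; rewrite g'0 subr0 addr0 -[h *: (1 : K)]/(h * 1) mulr1.
  by rewrite -g'd; exact: dg'.
have /= : \forall h \near 0^', 0 < h^-1 * g' h.
  by apply: (cvgr_gt _ lim).
move=> /nbhs_ballP[r /= r0 hr].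
pose m := Num.min r e / 2.
have m0 : 0 < m by rewrite divr_gt0// lt_min r0.
have mr : m < r by rewrite ltr_pdivrMr// (@le_lt_trans _ _ r) ?ge_min ?lexx//; lra.
have me : m < e by rewrite ltr_pdivrMr// (@le_lt_trans _ _ e) ?ge_min ?lexx ?orbT//;
  lra.
have dgm (t : K) : t \in `](- e), e[%R -> is_derive t 1 g (g' t) by move/lte/dg.
have dg0m (t : K) : t \in `]0, m[%R -> is_derive t 1 g (g' t).
  rewrite in_itv/= => /andP[t0 tm].
  by apply: dg; rewrite gtr0_norm//; exact: lt_trans me.
have cg0m : {within `[0, m], continuous g}.
  apply: derivable_within_continuous => t; rewrite in_itv/= => /andP[t0 tm].
  have dgt : is_derive t 1 g (g' t).
    by apply: dg; rewrite ger0_norm//; exact: le_lt_trans me.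
  exact: ex_derive.
have [c c_in gm] := MVT m0 dg0m cg0m.
move: c_in; rewrite in_itv/= => /andP[c0 cm].
have : 0 < c^-1 * g' c.
  apply: hr; rewrite /ball/= ?sub0r ?normrN ?gtr0_norm ?gt_eqF//.
  exact: lt_trans mr.
rewrite pmulr_rgt0 ?invr_gt0// => gc0.
have : 0 < g' c * (m - 0) by rewrite subr0 mulr_gt0.
by rewrite -gm subr_gt0 ltNge gmax// gtr0_norm.
Qed.

Lemma interior_max_second_derivative U w wv v p d : open U -> U p ->
  (forall q, U q -> is_derive q v w (wv q)) -> is_derive p v wv d ->
  (forall q, U q -> w q <= w p) -> d <= 0.
Proof.
move=> oU Up dw dwv wmax.
have lcont : (fun t : K => t *: v + p) @ (0 : K) --> (0 : K) *: v + p.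
  by apply: cvgD; [apply: cvgZr_tmp; exact: cvg_id|exact: cvg_cst].
rewrite scale0r add0r in lcont.
have /lcont/nbhs_ballP[e /= e0 He] : nbhs p U by exact: open_nbhs_nbhs.
have inU (t : K) : `|t| < e -> U (t *: v + p).
  by move=> te; apply: He; rewrite /ball/= sub0r normrN.
apply: (@second_derivative_at_max (fun t => w (t *: v + p))
          (fun t => wv (t *: v + p)) d e e0).
- by move=> t /inU Ut; apply: is_derive_line; exact: dw.
- by apply: is_derive_line; rewrite scale0r add0r.
- by move=> t /inU Ut; rewrite scale0r add0r; exact: wmax.
Qed.

(** The norm of the product [K * K] is the sup norm, whose balls are squares; round disks and annuli
    are expressed through this polynomial, which is differentiable at the origin too. *)
Definition sqnorm p : K := p.1 ^+ 2 + p.2 ^+ 2.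

Lemma sqnorm_ge0 p : 0 <= sqnorm p.
Proof. by rewrite addr_ge0 ?sqr_ge0. Qed.

Lemma continuous_fstK : continuous (fst : K * K -> K).
Proof. by move=> p; apply: cvg_fst. Qed.

Lemma continuous_sndK : continuous (snd : K * K -> K).
Proof. by move=> p; apply: cvg_snd. Qed.

Lemma continuous_sqnorm : continuous sqnorm.
Proof.
move=> p; apply: cvgD.
  by apply: (@continuous_comp _ _ _ (fst : K * K -> K) (fun x : K => x ^+ 2));
    [exact: continuous_fstK|exact: exprn_continuous].
by apply: (@continuous_comp _ _ _ (snd : K * K -> K) (fun x : K => x ^+ 2));
    [exact: continuous_sndK|exact: exprn_continuous].
Qed.

End DirectionalDerivatives.
Section MaximumPrinciple.
Variable K : realType.
Implicit Types (p q : K * K) (w L : K * K -> K) (U D : set (K * K)).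

Local Notation e1 := ((1, 0) : K * K).
Local Notation e2 := ((0, 1) : K * K).

(** The partial derivatives are witnesses constrained on U only, so that sums and multiples are
    handled witness by witness and local harmonicity needs no formula for the derivatives outside
    U. *)
Definition laplacian_on U w L : Prop :=
  exists wx wy wxx wyy : K * K -> K, forall p, U p ->
    [/\ is_derive p e1 w (wx p), is_derive p e2 w (wy p),
        is_derive p e1 wx (wxx p), is_derive p e2 wy (wyy p) &
        wxx p + wyy p = L p].

Lemma laplacian_onS U D w L : D `<=` U -> laplacian_on U w L ->
  laplacian_on D w L.
Proof.
by move=> DU [wx [wy [wxx [wyy H]]]]; exists wx, wy, wxx, wyy => p /DU/H.
Qed.

Lemma laplacian_onD U w1 w2 L1 L2 : laplacian_on U w1 L1 ->
  laplacian_on U w2 L2 -> laplacian_on U (w1 \+ w2) (L1 \+ L2).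
Proof.
move=> [wx [wy [wxx [wyy H]]]] [vx [vy [vxx [vyy H']]]].
exists (wx \+ vx), (wy \+ vy), (wxx \+ vxx), (wyy \+ vyy) => p Up.
have [? ? ? ? wL] := H p Up; have [? ? ? ? vL] := H' p Up.
split; try exact: is_deriveD.
by rewrite /= -wL -vL addrACA.
Qed.

Lemma laplacian_onZ U (c : K) w L : laplacian_on U w L ->
  laplacian_on U (c \*: w) (c \*: L).
Proof.
move=> [wx [wy [wxx [wyy H]]]].
exists (c \*: wx), (c \*: wy), (c \*: wxx), (c \*: wyy) => p Up.
have [? ? ? ? wL] := H p Up.
split; try exact: is_deriveZ.
by rewrite /= -wL scalerDr.
Qed.

Lemma laplacian_on_sqnorm U : laplacian_on U (@sqnorm K) (fun=> 4).
Proof.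
exists (fun p => 2 * p.1), (fun p => 2 * p.2), (fun=> 2), (fun=> 2) => p _.
have d1 v : is_derive p v (fst : K * K -> K) v.1 := is_derive_fst p v.
have d2 v : is_derive p v (snd : K * K -> K) v.2 := is_derive_snd p v.
have E : @sqnorm K = (fst : K * K -> K) * (fst : K * K -> K)
                     + (snd : K * K -> K) * (snd : K * K -> K) by [].
have dE v : is_derive p v (@sqnorm K) (2 * (p.1 * v.1 + p.2 * v.2)).
  rewrite E; apply: (is_derive_eq
    (is_deriveD (is_deriveM (d1 v) (d1 v)) (is_deriveM (d2 v) (d2 v)))).
  by rewrite /GRing.scale/=; ring.
split.
- by apply: (is_derive_eq (dE e1)); rewrite /= mulr1 mulr0 addr0.
- by apply: (is_derive_eq (dE e2)); rewrite /= mulr1 mulr0 add0r.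
- by apply: (is_derive_eq (is_deriveZ 2 (d1 e1))); rewrite /GRing.scale/= mulr1.
- by apply: (is_derive_eq (is_deriveZ 2 (d2 e2))); rewrite /GRing.scale/= mulr1.
- by rewrite -natrD.
Qed.

(** Adding a small multiple of |z|^2 makes the Laplacian strictly positive on U, while at a maximum
    inside U both pure second derivatives would be nonpositive; hence the maximum over the compact
    set D is attained in D minus U, which plays the part of the boundary. *)
Lemma max_principle D U w L (M : K) : compact D -> open U -> U `<=` D ->
  {within D, continuous w} -> laplacian_on U w L -> (forall p, U p -> 0 <= L p) ->
  (forall p, D p -> ~ U p -> w p <= M) -> forall p, D p -> w p <= M.
Proof.
move=> cD oU UD cw lapw L_ge0 wM p Dp.
have [c Dc c_max] : exists2 c, c \in D & forall q, q \in D -> sqnorm q <= sqnorm c.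
  apply: compact_EVT_max => //; first by exists p.
  exact/continuous_subspaceT/continuous_sqnorm.
rewrite leNgt; apply/negP => Mw.
(* Small enough for the added term to stay below half of the gap w(p) - M everywhere on D. *)
pose eta := (w p - M) / 2 / (1 + sqnorm c).
have s0 := sqnorm_ge0 c.
have eta_gt0 : 0 < eta by rewrite !divr_gt0// ?subr_gt0// ltr_wpDr.
pose v := w \+ eta \*: @sqnorm K.
have cv : {within D, continuous v}.
  move=> q; apply: continuousD; first exact: cw.
  apply: continuous_subspaceT => x; apply: cvgZl_tmp; exact: continuous_sqnorm.
have [q /set_mem Dq q_max] : exists2 q, q \in D & forall x, x \in D -> v x <= v q.
  by apply: compact_EVT_max => //; exists p.
have [Uq|nUq] := pselect (U q).
  have [vx [vy [vxx [vyy H]]]] :=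
    laplacian_onD lapw (laplacian_onZ eta (laplacian_on_sqnorm U)).
  have vmax x : U x -> v x <= v q by move=> /UD Dx; apply: q_max; exact: mem_set.
  have [_ _ dxx dyy Lq] := H q Uq.
  have xx_le : vxx q <= 0.
    by apply: (interior_max_second_derivative oU Uq _ dxx vmax) => x /H[].
  have yy_le : vyy q <= 0.
    by apply: (interior_max_second_derivative oU Uq _ dyy vmax) => x /H[].
  have : 0 < vxx q + vyy q.
    by rewrite Lq /= /GRing.scale/= ltr_wpDl ?L_ge0// mulr_gt0.
  by rewrite ltNge; apply/negP; rewrite negbK; lra.
have : v p <= v q by apply: q_max; exact: mem_set.
rewrite /v /= /GRing.scale/=.
have : 0 <= eta * sqnorm p by rewrite mulr_ge0 ?sqnorm_ge0// ltW.
have : eta * sqnorm q <= eta * sqnorm c.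
  by rewrite ler_wpM2l ?(ltW eta_gt0)// c_max//; exact: mem_set.
have : eta * sqnorm c <= (w p - M) / 2.
  rewrite /eta -[leRHS]mulr1 -mulrA ler_wpM2l ?divr_ge0 ?subr_ge0 ?(ltW Mw)//.
  by rewrite mulrC ler_pdivrMr ?ltr_wpDr//; lra.
have := wM q Dq nUq; lra.
Qed.

Lemma compact_sqnorm (a b : K) : compact [set p : K * K | a <= sqnorm p <= b].
Proof.
pose c := `|b| + 1.
apply: (@subclosed_compact _ _ (`[- c, c]%classic `*` `[- c, c]%classic)).
- have -> : [set p : K * K | a <= sqnorm p <= b] = @sqnorm K @^-1` `[a, b]%classic.
    by apply/seteqP; split=> q /=; rewrite in_itv.
  apply: closed_comp => [q _|]; first exact: continuous_sqnorm.
  exact: itv_closed.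
- by apply: compact_setX; exact: segment_compact.
- move=> q /= /andP[_ qb].
  have b0 := normr_ge0 b; have bb := ler_norm b.
  have bound (x : K) : x ^+ 2 <= b -> x \in `[- c, c].
    move=> xb; rewrite in_itv/= -ler_norml -(@ler_pXn2r _ 2) ?nnegrE ?addr_ge0//.
    rewrite real_normK ?num_real//; apply: le_trans xb _; rewrite /c sqrrD; nra.
  have q1 := sqr_ge0 q.1; have q2 := sqr_ge0 q.2.
  by split; apply: bound; move: qb; rewrite /sqnorm; lra.
Qed.

Lemma open_sqnorm (a b : K) : open [set p : K * K | a < sqnorm p < b].
Proof.
have -> : [set p : K * K | a < sqnorm p < b] = @sqnorm K @^-1` `]a, b[%classic.
  by apply/seteqP; split=> q /=; rewrite in_itv.
apply: open_comp => [q _|]; first exact: continuous_sqnorm.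
exact: itv_open.
Qed.

End MaximumPrinciple.

(** * Complex polynomials as pairs of harmonic functions *)

Section HarmonicPolynomials.
Variable K : realType.
Implicit Types (p q : K * K) (P : {poly K[i]}).

Local Notation e1 := ((1, 0) : K * K).
Local Notation e2 := ((0, 1) : K * K).

Definition re_poly P p : K := complex.Re P.[plane p].
Definition im_poly P p : K := complex.Im P.[plane p].

Lemma Re_mulc (x y : K[i]) : complex.Re (x * y) =
  complex.Re x * complex.Re y - complex.Im x * complex.Im y.
Proof. by case: x y => [a b] [c d]. Qed.

Lemma Im_mulc (x y : K[i]) : complex.Im (x * y) =
  complex.Re x * complex.Im y + complex.Im x * complex.Re y.
Proof. by case: x y => [a b] [c d]. Qed.

Lemma Re_addc (x y : K[i]) : complex.Re (x + y) = complex.Re x + complex.Re y.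
Proof. by case: x y => [a b] [c d]. Qed.

Lemma Im_addc (x y : K[i]) : complex.Im (x + y) = complex.Im x + complex.Im y.
Proof. by case: x y => [a b] [c d]. Qed.

Lemma re_polyMXaddC P c : re_poly (P * 'X + c%:P) =
  re_poly P * (fst : K * K -> K) - im_poly P * (snd : K * K -> K)
  + cst (complex.Re c).
Proof. by apply/funext => p; rewrite /re_poly !hornerE Re_addc Re_mulc. Qed.

Lemma im_polyMXaddC P c : im_poly (P * 'X + c%:P) =
  re_poly P * (snd : K * K -> K) + im_poly P * (fst : K * K -> K)
  + cst (complex.Im c).
Proof. by apply/funext => p; rewrite /im_poly !hornerE Im_addc Im_mulc. Qed.

Lemma continuous_re_im_poly P : continuous (re_poly P) /\ continuous (im_poly P).
Proof.
elim/poly_ind: P => [|P c [cr ci]].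
  have -> : re_poly 0 = cst 0 by apply/funext => q; rewrite /re_poly horner0.
  have -> : im_poly 0 = cst 0 by apply/funext => q; rewrite /im_poly horner0.
  by split=> q; exact: cvg_cst.
rewrite re_polyMXaddC im_polyMXaddC; split=> q.
  apply: cvgD; last exact: cvg_cst.
  apply: cvgB; apply: cvgM; [exact: cr|exact: continuous_fstK|exact: ci|].
  exact: continuous_sndK.
apply: cvgD; last exact: cvg_cst.
apply: cvgD; apply: cvgM; [exact: cr|exact: continuous_sndK|exact: ci|].
exact: continuous_fstK.
Qed.

(** The Cauchy-Riemann equations, by Horner induction on P X + c: the product rule reproduces (P X +
    c)' = P' X + P in real and imaginary parts. *)
Lemma is_derive_poly P p :
  [/\ is_derive p e1 (re_poly P) (re_poly P^`() p),
      is_derive p e1 (im_poly P) (im_poly P^`() p),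
      is_derive p e2 (re_poly P) (- im_poly P^`() p) &
      is_derive p e2 (im_poly P) (re_poly P^`() p)].
Proof.
elim/poly_ind: P => [|P c [d1 d2 d3 d4]].
  have -> : re_poly 0 = cst 0 by apply/funext => q; rewrite /re_poly horner0.
  have -> : im_poly 0 = cst 0 by apply/funext => q; rewrite /im_poly horner0.
  have -> : re_poly (0^`()) p = 0 by rewrite /re_poly deriv0 horner0.
  have -> : im_poly (0^`()) p = 0 by rewrite /im_poly deriv0 horner0.
  by rewrite oppr0; split; exact: is_derive_cst.
have f1 := is_derive_fst p e1; have f2 := is_derive_fst p e2.
have s1 := is_derive_snd p e1; have s2 := is_derive_snd p e2.
have rE : re_poly (P * 'X + c%:P)^`() p =
    re_poly P^`() p * p.1 - im_poly P^`() p * p.2 + re_poly P p.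
  by rewrite /re_poly derivMXaddC !hornerE Re_addc Re_mulc addrC.
have iE : im_poly (P * 'X + c%:P)^`() p =
    re_poly P^`() p * p.2 + im_poly P^`() p * p.1 + im_poly P p.
  by rewrite /im_poly derivMXaddC !hornerE Im_addc Im_mulc addrC.
rewrite rE iE re_polyMXaddC im_polyMXaddC.
split.
- apply: (is_derive_eq (is_deriveD (is_deriveB (is_deriveM d1 f1)
    (is_deriveM d2 s1)) (is_derive_cst _ _ _))).
  by rewrite /GRing.scale/=; ring.
- apply: (is_derive_eq (is_deriveD (is_deriveD (is_deriveM d1 s1)
    (is_deriveM d2 f1)) (is_derive_cst _ _ _))).
  by rewrite /GRing.scale/=; ring.
- apply: (is_derive_eq (is_deriveD (is_deriveB (is_deriveM d3 f2)
    (is_deriveM d4 s2)) (is_derive_cst _ _ _))).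
  by rewrite /GRing.scale/=; ring.
- apply: (is_derive_eq (is_deriveD (is_deriveD (is_deriveM d3 s2)
    (is_deriveM d4 f2)) (is_derive_cst _ _ _))).
  by rewrite /GRing.scale/=; ring.
Qed.

Lemma laplacian_on_re_poly U P : laplacian_on U (re_poly P) (fun=> 0).
Proof.
exists (re_poly P^`()), (- im_poly P^`()), (re_poly P^`()^`()),
  (- re_poly P^`()^`()) => p _.
have [d1 _ d3 _] := is_derive_poly P p.
have [d1' _ _ d4'] := is_derive_poly P^`() p.
split=> //; first exact: is_deriveN.
by rewrite subrr.
Qed.

End HarmonicPolynomials.
(** * Functions whose Laplacian is compactly supported *)

Section SmoothFunctions.
Variable K : realType.
Implicit Types (p q v : K * K) (u f g : K * K -> K) (U : set (K * K)).

Local Notation e1 := ((1, 0) : K * K).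
Local Notation e2 := ((0, 1) : K * K).

Lemma C_k_is_derive k f : C_k k.+1 f -> forall p,
  is_derive p e1 f (partial_x f p) /\ is_derive p e2 f (partial_y f p).
Proof. by case=> _ dx dy _ _ p; split; apply: derivableP. Qed.

Lemma C_k_partial k f : C_k k.+1 f ->
  C_k k (partial_x f) /\ C_k k (partial_y f).
Proof. by case. Qed.

Lemma C_k_continuous k f : C_k k f -> continuous f.
Proof. by case: k => // k []. Qed.

Lemma C_kW k f : C_k k.+1 f -> C_k k f.
Proof.
elim: k f => [|k IH] f; first by case.
by case=> cf dx dy /IH hx /IH hy; split.
Qed.

(** Two applications of the mean value theorem, along v1 to the difference of two parallel
    restrictions of f, then along v2 to g. *)
Lemma second_difference f g h v1 v2 :
  (forall q, is_derive q v1 f (g q)) -> (forall q, is_derive q v2 g (h q)) ->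
  forall p (r : K), 0 < r -> exists s t : K,
    [/\ 0 < s < r, 0 < t < r &
    f (r *: v1 + (r *: v2 + p)) - f (r *: v1 + p) - (f (r *: v2 + p) - f p)
    = h (t *: v2 + (s *: v1 + p)) * r * r].
Proof.
move=> df dg p r r0.
pose G (t : K) := f (t *: v1 + (r *: v2 + p)) - f (t *: v1 + p).
have dG (t : K) : is_derive t 1 G
    (g (t *: v1 + (r *: v2 + p)) - g (t *: v1 + p)).
  by apply: is_deriveB; apply: is_derive_line.
have cG (a b : K) : {within `[a, b], continuous G}.
  by apply: derivable_within_continuous => t _; have dGt := dG t; exact: ex_derive.
have [s s_in Gs] := MVT r0 (fun t _ => dG t) (cG 0 r).
pose H (t : K) := g (t *: v2 + (s *: v1 + p)).
have dH (t : K) : is_derive t 1 H (h (t *: v2 + (s *: v1 + p))).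
  exact: is_derive_line.
have cH (a b : K) : {within `[a, b], continuous H}.
  by apply: derivable_within_continuous => t _; have dHt := dH t; exact: ex_derive.
have [t t_in Ht] := MVT r0 (fun t _ => dH t) (cH 0 r).
exists s, t; split.
- by move: s_in; rewrite in_itv.
- by move: t_in; rewrite in_itv.
- move: Gs Ht; rewrite /G /H !scale0r !add0r subr0.
  by rewrite [s *: v1 + (r *: v2 + p)]addrCA => -> ->.
Qed.

Lemma separated_by_half (x y z : K) :
  `|x - z| < `|x - y| / 2 -> `|y - z| < `|x - y| / 2 -> False.
Proof. by have := ler_distD z x y; rewrite (distrC z y); lra. Qed.

(** Schwarz's theorem: the second difference over a small square is symmetric in the two directions,
    so the two mixed partials take a common value at points arbitrarily close to p, and continuity
    forces equality at p. *)
Lemma mixed_partials f : C_k 2 f -> partial_x (partial_y f) = partial_y (partial_x f).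
Proof.
move=> Cf; have [Cx Cy] := C_k_partial Cf.
have df p := C_k_is_derive Cf p.
have dx p := C_k_is_derive Cx p; have dy p := C_k_is_derive Cy p.
have [_ /C_k_continuous cxy] := C_k_partial Cx.
have [/C_k_continuous cyx _] := C_k_partial Cy.
apply/funext => p; apply/eqP; rewrite -subr_eq0; apply/negPn/negP => neq.
set a := partial_x (partial_y f) in neq cyx *.
set b := partial_y (partial_x f) in neq cxy *.
have e_gt0 : 0 < `|a p - b p| / 2 by rewrite divr_gt0 ?normr_gt0.
have : \forall q \near p, `|a p - a q| < `|a p - b p| / 2.
  by have /cvgrPdist_lt := cyx p; apply.
have : \forall q \near p, `|b p - b q| < `|a p - b p| / 2.
  by have /cvgrPdist_lt := cxy p; apply.
move=> /nbhs_ballP[r1 /= r1_gt0 br1] /nbhs_ballP[r2 /= r2_gt0 br2].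
pose r := Num.min r1 r2.
have r_gt0 : 0 < r by rewrite lt_min r1_gt0.
have [s [t [/andP[s0 sr] /andP[t0 tr] S1]]] :=
  second_difference (fun q => (df q).1) (fun q => (dx q).2) p r_gt0.
have [t' [s' [/andP[t0' tr'] /andP[s0' sr'] S2]]] :=
  second_difference (fun q => (df q).2) (fun q => (dy q).1) p r_gt0.
have in_ball (x y z : K) : 0 < x < r -> 0 < y < r -> r <= z ->
    ball p z (y *: e2 + (x *: e1 + p)).
  move=> /andP[x0 xr] /andP[y0 yr] rz; split; rewrite /ball/= /GRing.scale/=.
    by rewrite mulr1 mulr0 add0r opprD addrCA subrr addr0 normrN gtr0_norm//; lra.
  rewrite mulr1 mulr0 add0r opprD addrCA subrr addr0 normrN gtr0_norm//; lra.
have h1 : `|b p - b (t *: e2 + (s *: e1 + p))| < `|a p - b p| / 2.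
  by apply: br1; apply: in_ball; rewrite ?s0 ?t0// ge_min lexx.
have h2 : `|a p - a (s' *: e1 + (t' *: e2 + p))| < `|a p - b p| / 2.
  rewrite addrCA; apply: br2.
  by apply: in_ball; rewrite ?s0' ?t0'// ge_min lexx orbT.
have ab : b (t *: e2 + (s *: e1 + p)) = a (s' *: e1 + (t' *: e2 + p)).
  have r_neq0 : r != 0 by rewrite gt_eqF.
  apply: (mulIf r_neq0); apply: (mulIf r_neq0).
  apply: etrans (esym S1) _; apply: etrans _ S2.
  have -> : r *: e2 + (r *: e1 + p) = r *: e1 + (r *: e2 + p) by exact: addrCA.
  by move: (f _) (f _) (f _) (f _) => x1 x2 x3 x4; ring.
apply: (separated_by_half h2); rewrite -ab; exact: h1.
Qed.

Lemma laplacian_on_C2 U u : C_k 2 u -> laplacian_on U u (real_laplacian u).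
Proof.
move=> Cu; have [Cx Cy] := C_k_partial Cu.
exists (partial_x u), (partial_y u), (partial_x (partial_x u)),
  (partial_y (partial_y u)) => p _.
have [d1 d2] := C_k_is_derive Cu p.
have [d3 _] := C_k_is_derive Cx p; have [_ d4] := C_k_is_derive Cy p.
by split.
Qed.

Lemma derive_eq0_of_near f v p : (\forall q \near p, f q = 0) -> 'D_v f p = 0.
Proof.
have [->|v0] := eqVneq v 0; first by rewrite derive0.
move=> f0; rewrite -[RHS](derive_cst (0 : K) p v).
by apply: near_eq_derive => //; apply: filterS f0 => q ->.
Qed.

Lemma is_derive_mulD p v (A B f g : K * K -> K) (a b c d : K) :
  is_derive p v A a -> is_derive p v f c -> is_derive p v B b ->
  is_derive p v g d ->
  is_derive p v (A * f + B * g) (a * f p + A p * c + (b * g p + B p * d)).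
Proof.
move=> dA df dB dg.
apply: (is_derive_eq (is_deriveD (is_deriveM dA df) (is_deriveM dB dg))).
by rewrite /GRing.scale/=; ring.
Qed.

(** The Laplacian of A u_x + B u_y for a polynomial A + iB, with the Cauchy-Riemann equations
    already substituted: (A1, B1) and (A2, B2) stand for its first and second derivatives, a and b
    for the pure second derivatives of u_x, c and d for those of u_y. *)
Lemma product_laplacian_eq0 (A A1 A2 B B1 B2 ux uy uxx uxy uyx uyy a b c d : K) :
  uyx = uxy -> uxx + uyy = 0 -> a + b = 0 -> c + d = 0 ->
  A2 * ux + A1 * uxx + (A1 * uxx + A * a)
    + (B2 * uy + B1 * uyx + (B1 * uyx + B * c))
  + (- A2 * ux + - B1 * uxy + (- B1 * uxy + A * b)
    + (- B2 * uy + A1 * uyy + (A1 * uyy + B * d))) = 0.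
Proof.
move=> -> /eqP; rewrite addr_eq0 => /eqP-> /eqP; rewrite addr_eq0 => /eqP->.
by move=> /eqP; rewrite addr_eq0 => /eqP->; ring.
Qed.

(* The real part of the product of a polynomial with the holomorphic function
   [u_x - i u_y] is harmonic wherever [u] is. *)
Lemma laplacian_on_poly_gradient U u (P : {poly K[i]}) : C_k 3 u -> open U ->
  (forall p, U p -> real_laplacian u p = 0) ->
  laplacian_on U (re_poly P * partial_x u + im_poly P * partial_y u) (fun=> 0).
Proof.
move=> C3 oU lap0; have C2 := C_kW C3; have [Cx Cy] := C_k_partial C3.
have [Cxx Cxy] := C_k_partial Cx; have [Cyx Cyy] := C_k_partial Cy.
have xyE := mixed_partials C2.
have xyxE := mixed_partials Cx; have xyyE := mixed_partials Cy.
have lap0' p : U p -> partial_x (partial_x u) p + partial_y (partial_y u) p = 0.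
  exact: lap0.
(* The function u_x is itself harmonic on U: the Laplacian of u vanishes near p, hence so does its
   x-derivative, and the partials commute. The same is then done for u_y. *)
have lxE p : U p -> partial_x (partial_x (partial_x u)) p +
    partial_y (partial_y (partial_x u)) p = 0.
  move=> Up; have [d1 _] := C_k_is_derive Cxx p.
  have [d2 _] := C_k_is_derive Cyy p.
  have lap_near : \forall q \near p, real_laplacian u q = 0.
    by apply: filterS (open_nbhs_nbhs (conj oU Up)) => q; exact: lap0.
  rewrite -xyE -xyyE -(derive_eq0_of_near e1 lap_near).
  exact: esym (@derive_val _ _ _ _ _ _ _ (is_deriveD d1 d2)).
have lyE p : U p -> partial_x (partial_x (partial_y u)) p +
    partial_y (partial_y (partial_y u)) p = 0.
  move=> Up; have [_ d1] := C_k_is_derive Cxx p.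
  have [_ d2] := C_k_is_derive Cyy p.
  have lap_near : \forall q \near p, real_laplacian u q = 0.
    by apply: filterS (open_nbhs_nbhs (conj oU Up)) => q; exact: lap0.
  rewrite xyE xyxE -(derive_eq0_of_near e2 lap_near).
  exact: esym (@derive_val _ _ _ _ _ _ _ (is_deriveD d1 d2)).
have xyEp p : partial_x (partial_y u) p = partial_y (partial_x u) p.
  by rewrite xyE.
have dux p := C_k_is_derive Cx p; have duy p := C_k_is_derive Cy p.
have duxx p := C_k_is_derive Cxx p; have duxy p := C_k_is_derive Cxy p.
have duyx p := C_k_is_derive Cyx p; have duyy p := C_k_is_derive Cyy p.
have dP p := is_derive_poly P p; have dP1 p := is_derive_poly P^`() p.
move: (re_poly P) (im_poly P) (re_poly P^`()) (im_poly P^`())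
  (re_poly P^`()^`()) (im_poly P^`()^`()) dP dP1 => A B A1 B1 A2 B2 dP dP1.
exists (A1 * partial_x u + A * partial_x (partial_x u)
        + (B1 * partial_y u + B * partial_x (partial_y u))),
  (- B1 * partial_x u + A * partial_y (partial_x u)
   + (A1 * partial_y u + B * partial_y (partial_y u))),
  (fun p => A2 p * partial_x u p + A1 p * partial_x (partial_x u) p
     + (A1 p * partial_x (partial_x u) p
        + A p * partial_x (partial_x (partial_x u)) p)
     + (B2 p * partial_y u p + B1 p * partial_x (partial_y u) p
     + (B1 p * partial_x (partial_y u) p
        + B p * partial_x (partial_x (partial_y u)) p))),
  (fun p => - A2 p * partial_x u p + - B1 p * partial_y (partial_x u) p
     + (- B1 p * partial_y (partial_x u) p
        + A p * partial_y (partial_y (partial_x u)) p)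
     + (- B2 p * partial_y u p + A1 p * partial_y (partial_y u) p
     + (A1 p * partial_y (partial_y u) p
        + B p * partial_y (partial_y (partial_y u)) p))) => p Up.
have [A_x B_x A_y B_y] := dP p; have [A1_x B1_x A1_y B1_y] := dP1 p.
split.
- exact: is_derive_mulD A_x (dux p).1 B_x (duy p).1.
- exact: is_derive_mulD A_y (dux p).2 B_y (duy p).2.
- exact: is_deriveD (is_derive_mulD A1_x (dux p).1 A_x (duxx p).1)
    (is_derive_mulD B1_x (duy p).1 B_x (duyx p).1).
- exact: is_deriveD
    (is_derive_mulD (is_deriveN B1_y) (dux p).2 A_y (duxy p).2)
    (is_derive_mulD A1_y (duy p).2 B_y (duyy p).2).
- exact: product_laplacian_eq0 (xyEp p) (lap0' p Up) (lxE p Up) (lyE p Up).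
Qed.

End SmoothFunctions.

(** * Vanishing outside the support of the Laplacian, and the barrier *)

Section LaplacianSupport.
Variable K : realType.
Implicit Types (p q v : K * K) (u w : K * K -> K).

Local Notation e1 := ((1, 0) : K * K).
Local Notation e2 := ((0, 1) : K * K).
Local Notation normc := Normc.normc.

Lemma normc_plane q : normc (plane q) = Num.sqrt (sqnorm q).
Proof. by []. Qed.

Lemma sqnorm_move (t : K) q : sqnorm (t *: e1 + q) = (t + q.1) ^+ 2 + q.2 ^+ 2.
Proof. by rewrite /sqnorm /= /GRing.scale/= mulr1 mulr0 add0r. Qed.

Lemma le0_of_geometric_bound (x F y : K) : 0 <= x < 1 ->
  (forall m, y <= x ^+ m * F) -> y <= 0.
Proof.
move=> /andP[x0 x1] yF; rewrite leNgt; apply/negP => y0.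
have lim : (fun m => x ^+ m * F) @ \oo --> 0 * F.
  by apply: cvgMr_tmp; apply: cvg_expr; rewrite ger0_norm.
rewrite mul0r in lim.
have /filter_ex[m] : \forall m \near \oo, x ^+ m * F < y by exact: (cvgr_lt _ lim).
by rewrite ltNge yF.
Qed.

Lemma partial_eq0_far u (b : K) p : (forall q, b < sqnorm q -> u q = 0) ->
  b < sqnorm p -> partial_x u p = 0 /\ partial_y u p = 0.
Proof.
move=> u0 bp; have u_near : \forall q \near p, u q = 0.
  have : \forall q \near p, b < sqnorm q.
    by apply: (cvgr_gt _ (@continuous_sqnorm K p)).
  by apply: filterS => q; exact: u0.
by split; apply: derive_eq0_of_near.
Qed.

Lemma normc_conjc (x : K[i]) : normc (conjc x) = normc x.
Proof. by case: x => a b /=; rewrite sqrrN. Qed.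

Lemma Re_conjcM (x : K[i]) : complex.Re (conjc x * x) = normc x ^+ 2.
Proof.
case: x => a b; rewrite Re_mulc /= sqr_sqrtr ?addr_ge0 ?sqr_ge0//.
by rewrite mulNr opprK !expr2.
Qed.

Lemma continuous_abs_gradient u : C_k 1 u ->
  continuous (fun q => `|partial_x u q| + `|partial_y u q|).
Proof.
move=> C1 q; have [/C_k_continuous cx /C_k_continuous cy] := C_k_partial C1.
by apply: cvgD; apply: cvg_norm; [exact: cx|exact: cy].
Qed.

(* Writing [f = u_x - i u_y], the maximum principle for [Re (c z^m f)] on the
   annulus [a <= |z|^2 <= c'] gives [|z|^m |f z| <= a^(m/2) F] for all [m]. *)
Lemma gradient_eq0_outside u (a b : K) p : C_k 3 u -> 0 <= a ->
  (forall q, a <= sqnorm q -> real_laplacian u q = 0) ->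
  (forall q, b < sqnorm q -> u q = 0) -> a < sqnorm p ->
  partial_x u p = 0 /\ partial_y u p = 0.
Proof.
move=> C3 a0 lap0 u0 ap; have C1 : C_k 1 u by apply/C_kW/C_kW.
have [cx cy] := C_k_partial C1.
pose f q : K[i] := (partial_x u q) +i* (- partial_y u q).
have f_le q : normc (f q) <= `|partial_x u q| + `|partial_y u q|.
  by rewrite (le_trans (normc_le_ReIm _))//= normrN.
(* The outer radius lies beyond p and beyond the support of u, so that f vanishes on the outer
   circle. *)
pose c := Num.max b (sqnorm p) + 1.
have bc : b < c by rewrite ltr_pwDr// le_max lexx.
have pc : sqnorm p < c by rewrite ltr_pwDr// le_max lexx orbT.
pose D := [set q : K * K | a <= sqnorm q <= c].
have Dp : D p by rewrite /D/= !ltW.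
have [q0 _ q0_max] : exists2 q0, q0 \in D & forall q, q \in D ->
    `|partial_x u q| + `|partial_y u q| <= `|partial_x u q0| + `|partial_y u q0|.
  apply: compact_EVT_max; [by exists p|exact: compact_sqnorm|].
  exact/continuous_subspaceT/continuous_abs_gradient.
set F := `|partial_x u q0| + `|partial_y u q0| in q0_max.
have F0 : 0 <= F by rewrite addr_ge0.
set r := Num.sqrt (sqnorm p).
have r0 : 0 < r by rewrite sqrtr_gt0 (le_lt_trans a0).
have bound m : normc (f p) <= (Num.sqrt a / r) ^+ m * F.
  (* The maximum principle is for real functions. Multiplying z^m f by the conjugate of its value g
     at p makes the real part at p equal to |g|^2, which turns a bound on a real part into a bound
     on the modulus of g. *)
  pose g := plane p ^+ m * f p.
  suff : normc g <= Num.sqrt a ^+ m * F.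
    rewrite Normc.normcM normcX normc_plane -/r expr_div_n mulrAC.
    by rewrite ler_pdivlMr ?exprn_gt0// mulrC.
  have [->|g0] := eqVneq g 0.
    by rewrite Normc.normc0 mulr_ge0// exprn_ge0// sqrtr_ge0.
  have g_gt0 : 0 < normc g.
    by rewrite lt_def normc_ge0 andbT; apply: contra g0 => /eqP/Normc.eq0_normc ->.
  pose P : {poly K[i]} := (conjc g)%:P * 'X^m.
  have PE q : P.[plane q] = conjc g * plane q ^+ m by rewrite /P !hornerE.
  pose w := re_poly P * partial_x u + im_poly P * partial_y u.
  have wE q : w q = complex.Re (P.[plane q] * f q).
    by rewrite Re_mulc /= mulrN opprK.
  suff : w p <= normc g * Num.sqrt a ^+ m * F.
    have -> : w p = normc g ^+ 2.
      by rewrite wE PE -[_ * f p]mulrA -/g Re_conjcM.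
    by rewrite expr2 -mulrA ler_pM2l.
  apply: (@max_principle K D [set q | a < sqnorm q < c] w (fun=> 0)) => //.
  - exact: compact_sqnorm.
  - exact: open_sqnorm.
  - by move=> q /= /andP[? ?]; apply/andP; split; exact: ltW.
  - apply: continuous_subspaceT => q.
    have [crP ciP] := continuous_re_im_poly P.
    apply: cvgD; apply: cvgM; [exact: crP|exact: C_k_continuous cx q|
      exact: ciP|exact: C_k_continuous cy q].
  - apply: laplacian_on_poly_gradient => //; first exact: open_sqnorm.
    by move=> q /= /andP[/ltW aq _]; exact: lap0.
  - move=> q Dq nUq; move: (Dq) => /= /andP[aq qc].
    (* Beyond b the gradient is zero; any other boundary point of the annulus lies on the inner
       circle, where |z|^m is a^(m/2) and |f| <= F. *)
    have [bq|qb] := ltP b (sqnorm q).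
      have [x0 y0] := partial_eq0_far u0 bq.
      have -> : w q = 0.
        by rewrite wE /f x0 y0 oppr0 [_ +i* _](_ : _ = 0)// mulr0.
      by rewrite !mulr_ge0// ?normc_ge0// exprn_ge0// sqrtr_ge0.
    have {qc} qc : sqnorm q < c by exact: le_lt_trans bc.
    have aqE : sqnorm q = a.
      apply/eqP; rewrite eq_le aq andbT leNgt; apply/negP => qa.
      by apply: nUq; rewrite /= qa qc.
    rewrite wE PE; apply: le_trans (ler_Re_normc _) _.
    have gm_ge0 : 0 <= normc g * Num.sqrt a ^+ m.
      by rewrite mulr_ge0 ?normc_ge0 ?exprn_ge0 ?sqrtr_ge0.
    have -> : normc (conjc g * plane q ^+ m * f q) =
              normc g * Num.sqrt a ^+ m * normc (f q).
      rewrite Normc.normcM (Normc.normcM (conjc g)) normc_conjc.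
      by rewrite normcX normc_plane aqE.
    apply: (ler_wpM2l gm_ge0); apply: le_trans (f_le q) _.
    by apply: q0_max; exact: mem_set.
have ratio : 0 <= Num.sqrt a / r < 1.
  by rewrite divr_ge0 ?sqrtr_ge0//= ltr_pdivrMr// mul1r ltr_sqrt// (le_lt_trans a0).
have fp0 := le0_of_geometric_bound ratio bound.
have : f p = 0 by apply: Normc.eq0_normc; apply/eqP; rewrite eq_le fp0 normc_ge0.
by case=> -> /eqP; rewrite oppr_eq0 => /eqP ->.
Qed.

(** The gradient vanishes for |z|^2 > a, so u is constant along a horizontal segment leaving p away
    from the vertical axis: to the right if p.1 >= 0, to the left otherwise. Along it |z| increases
    strictly, so the interior of the segment avoids the closed disk even when p is on its boundary.
    The length T satisfies T^2 > b and takes the end point out of the support. *)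
Lemma eq0_outside u (a b : K) p : C_k 3 u -> 0 <= a ->
  (forall q, a <= sqnorm q -> real_laplacian u q = 0) ->
  (forall q, b < sqnorm q -> u q = 0) -> a <= sqnorm p -> u p = 0.
Proof.
move=> C3 a0 lap0 u0 ap; pose T := `|b| + 1.
have du q := (C_k_is_derive C3 q).1.
have dline (t : K) : is_derive t 1 (fun s : K => u (s *: e1 + p))
    (partial_x u (t *: e1 + p)) by exact: is_derive_line.
have cline (x y : K) : {within `[x, y], continuous (fun s : K => u (s *: e1 + p))}.
  apply: derivable_within_continuous => t _.
  by have dt := dline t; exact: ex_derive.
have T1 : 1 <= T by rewrite lerDr.
have T0 : 0 < T by exact: lt_le_trans T1.
have bT : b < T ^+ 2.
  rewrite expr2 (@lt_le_trans _ _ T)//; first by rewrite ltr_pwDr// ler_norm.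
  by rewrite ler_peMl// ltW.
have p2 := sqr_ge0 p.2.
have grad0 q := @gradient_eq0_outside u a b q C3 a0 lap0 u0.
have [x0|x0] := lerP 0 p.1.
  have [t t_in] := MVT T0 (fun t _ => dline t) (cline 0 T).
  move: t_in; rewrite in_itv/= => /andP[t0 tT].
  have [-> _] : partial_x u (t *: e1 + p) = 0 /\ partial_y u (t *: e1 + p) = 0.
    apply: grad0; apply: le_lt_trans ap _.
    rewrite sqnorm_move ltrD2r ltr_pXn2r// ?nnegrE ?addr_ge0 ?(ltW t0)//.
    by rewrite ltrDr.
  rewrite mul0r scale0r add0r u0 ?sub0r; last first.
    rewrite sqnorm_move; apply: lt_le_trans bT _.
    rewrite -[leLHS]addr0 lerD// lerXn2r ?nnegrE ?addr_ge0 ?(ltW T0)//.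
    by rewrite lerDl.
  by move/eqP; rewrite oppr_eq0 => /eqP.
have nT0 : - T < 0 by rewrite oppr_lt0.
have [t t_in] := MVT nT0 (fun t _ => dline t) (cline (- T) 0).
move: t_in; rewrite in_itv/= => /andP[tT t0].
have [-> _] : partial_x u (t *: e1 + p) = 0 /\ partial_y u (t *: e1 + p) = 0.
  apply: grad0; apply: le_lt_trans ap _.
  rewrite sqnorm_move ltrD2r -sqrrN -[ltRHS]sqrrN.
  rewrite ltr_pXn2r// ?nnegrE; lra.
rewrite mul0r scale0r add0r (u0 (- T *: e1 + p)) ?subr0//.
rewrite sqnorm_move; apply: lt_le_trans bT _.
rewrite -[leLHS]addr0 lerD// -[leRHS]sqrrN lerXn2r// ?nnegrE; lra.
Qed.

(** Barrier argument: |z|^2 has Laplacian 4, so w + (c/4) |z|^2 is subharmonic in the disk, and on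
    the circle it is at most c r2 / 4. *)
Lemma le_of_laplacian_ge w (L : K * K -> K) (c r2 : K) p : continuous w ->
  laplacian_on setT w L -> (forall q, sqnorm q < r2 -> - c <= L q) ->
  (forall q, sqnorm q = r2 -> w q <= 0) -> sqnorm p <= r2 ->
  w p <= c / 4 * (r2 - sqnorm p).
Proof.
move=> cw lapw lap_ge w0 pr2.
suff : (w \+ (c / 4) \*: @sqnorm K) p <= c / 4 * r2.
  by rewrite /= /GRing.scale/= mulrBr; lra.
(* The lower bounds 0 and -1 are vacuous: they present the closed and the open disk as annuli. *)
apply: (@max_principle K [set q | 0 <= sqnorm q <= r2] [set q | -1 < sqnorm q < r2]
  _ (L \+ (c / 4) \*: (fun=> 4))).
- exact: compact_sqnorm.
- exact: open_sqnorm.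
- by move=> q /= /andP[_ /ltW ->]; rewrite sqnorm_ge0.
- apply: continuous_subspaceT => q; apply: cvgD; first exact: cw.
  by apply: cvgZl_tmp; exact: continuous_sqnorm.
- by apply: laplacian_onD; [exact: laplacian_onS lapw|
    apply: laplacian_onZ; exact: laplacian_on_sqnorm].
- move=> q /= /andP[_ qr]; rewrite /GRing.scale/=.
  by have := lap_ge q qr; lra.
- move=> q /= /andP[_ qr] nU; have qE : sqnorm q = r2.
    apply/eqP; rewrite eq_le qr leNgt; apply/negP => qlt; apply: nU.
    by rewrite qlt (@lt_le_trans _ _ 0) ?sqnorm_ge0 ?oppr_lt0.
  by rewrite /GRing.scale/= qE; have := w0 q qE; lra.
- by rewrite /= sqnorm_ge0.
Qed.

End LaplacianSupport.
(** * Approximation of harmonic functions in a disk *)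

Section CircleApproximation.
Variable K : realType.
Implicit Types (q : K * K) (u : K * K -> K) (z : K[i]) (N k m : nat).

Local Notation normc := Normc.normc.

Lemma exists_primitive_root (C : numClosedFieldType) n : (0 < n)%N ->
  exists z : C, n.-primitive_root z.
Proof.
pose p : {poly C} := 'X^n - 1; have [r Dp] := closed_field_poly_normal p.
move=> n_gt0; rewrite (monicP _) ?monicXnsubC// scale1r in Dp.
have rn1 : all n.-unity_root r.
  by apply/allP => z; rewrite -root_prod_XsubC -Dp.
have sz_r : (n < (size r).+1)%N.
  by rewrite -(size_prod_XsubC r id) -Dp size_XnsubC.
have [|z] := hasP (cyclic.has_prim_root n_gt0 rn1 _ sz_r); last by exists z.
rewrite -separable.separable_prod_XsubC -Dp cyclotomic.separable_Xn_sub_1//.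
by rewrite pnatr_eq0 -lt0n.
Qed.

Lemma leq_bin_central N k : ('C(2 * N, N + k) <= 'C(2 * N, N))%N.
Proof.
elim: k => [|k IH]; first by rewrite addn0.
apply: leq_trans IH; rewrite addnS.
have := mul_bin_left (2 * N) (N + k); rewrite mul2n -addnn subnDl => E.
rewrite -(@leq_pmul2l (N + k).+1)// E leq_mul2r.
by rewrite (leq_trans (leq_subr _ _)) ?orbT// leqW// leq_addr.
Qed.

Lemma leq_bin_mid N k : ('C(2 * N, k) <= 'C(2 * N, N))%N.
Proof.
have [Nk|kN] := leqP N k; first by rewrite -(subnKC Nk) leq_bin_central.
have k2 : (k <= 2 * N)%N by rewrite mul2n -addnn (leq_trans (ltnW kN))// leq_addr.
rewrite -bin_sub//.
have -> : (2 * N - k = N + (N - k))%N by rewrite mul2n -addnn addnBA// ltnW.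
exact: leq_bin_central.
Qed.

(** The 2N + 1 binomials of 2N add up to 4^N and the central one is the largest. This bounds the
    normalization of the kernel from below, with a loss that is only linear in N. *)
Lemma expn4_le_central N : (4 ^ N <= (2 * N).+1 * 'C(2 * N, N))%N.
Proof.
rewrite -[4%N]/(2 ^ 2)%N -expnM -[2%N in X in (X <= _)%N]/(1 + 1)%N expnDn.
rewrite -[X in (_ <= X * _)%N]card_ord -sum_nat_const.
by apply: leq_sum => i _; rewrite !exp1n !muln1 leq_bin_mid.
Qed.

(* Coefficients of [|1 + z|^(2N)] on the unit circle, folded onto nonnegative powers
   of [z] by taking real parts. *)
Definition kernel_coef N k : nat :=
  if k is 0 then 'C(2 * N, N) else 2 * 'C(2 * N, N + k).

Lemma kernel_coef_le N k : (kernel_coef N k <= 2 * kernel_coef N 0)%N.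
Proof.
by case: k => [|k] /=; rewrite ?leq_pmull// leq_mul2l leq_bin_central.
Qed.

Lemma normc_unitP z : normc z = 1 -> z * conjc z = 1.
Proof.
case: z => a b /= ab1; apply/eqP; rewrite eq_complex /=.
have : Num.sqrt (a ^+ 2 + b ^+ 2) ^+ 2 = 1 by rewrite ab1 expr1n.
rewrite sqr_sqrtr ?addr_ge0 ?sqr_ge0// => E.
by apply/andP; split; apply/eqP; [rewrite -E; ring|ring].
Qed.

Lemma Re_sum (I : Type) (r : seq I) (P : pred I) (F : I -> K[i]) :
  complex.Re (\sum_(i <- r | P i) F i) =
  \sum_(i <- r | P i) complex.Re (F i).
Proof. by elim/big_ind2: _ => // x1 x2 y1 y2 <- <-; exact: Re_addc. Qed.

Lemma Re_realM (r : K) z : complex.Re (r%:C * z) = r * complex.Re z.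
Proof. by rewrite Re_mulc /= mul0r subr0. Qed.

Lemma Re_natM k z : complex.Re (k%:R * z) = k%:R * complex.Re z.
Proof. by rewrite -(rmorph_nat (real_complex K)) Re_realM. Qed.

Lemma Re_conjcX z k : complex.Re (conjc z ^+ k) = complex.Re (z ^+ k).
Proof. by rewrite -rmorphXn /=; case: (z ^+ k). Qed.

Lemma normc_sqr_unit z : normc z = 1 ->
  (normc (1 + z) ^+ 2)%:C = conjc z * (1 + z) ^+ 2.
Proof.
move=> /normc_unitP z1.
have -> : (normc (1 + z) ^+ 2)%:C = (1 + z) * (1 + conjc z).
  case: z z1 => a b _; apply/eqP; rewrite eq_complex /=.
  rewrite sqr_sqrtr ?addr_ge0 ?sqr_ge0//.
  by apply/andP; split; apply/eqP; ring.
by rewrite expr2 mulrCA; congr (_ * _); rewrite mulrDr mulr1 mulrC z1 addrC.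
Qed.

(** On the unit circle |1 + z|^2 = conj(z) (1 + z)^2, so the right-hand side is conj(z)^N (1 +
    z)^(2N). In the binomial expansion, terms at equal distance from index N carry equal binomials
    and conjugate powers; taking real parts merges them in pairs. *)
Lemma kernelE N z : normc z = 1 ->
  complex.Re (\sum_(k < N.+1) (kernel_coef N k)%:R * z ^+ k) =
  normc (1 + z) ^+ 2 ^+ N.
Proof.
move=> z1; have zz := normc_unitP z1.
pose F k := ('C(2 * N, N + k))%:R * complex.Re (z ^+ k).
transitivity (complex.Re ((normc (1 + z) ^+ 2 ^+ N)%:C)); last by [].
rewrite rmorphXn/= normc_sqr_unit// exprMn -exprM addrC exprDn mulr_sumr.
rewrite Re_sum (eq_bigr (fun k : 'I_N.+1 => (kernel_coef N k)%:R *
  complex.Re (z ^+ k))) => [|k _]; last by rewrite Re_natM.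
rewrite [RHS]Re_sum.
have -> : (2 * N).+1 = (N + N.+1)%N by rewrite mul2n -addnn addnS.
rewrite big_split_ord/=.
have -> : \sum_(i < N) complex.Re (conjc z ^+ N *
     (z ^+ (2 * N - i) * 1 ^+ i *+ 'C(2 * N, i))) = \sum_(i < N) F i.+1.
  rewrite (reindex_inj rev_ord_inj); apply: eq_bigr => i _ /=.
  have iN := ltn_ord i.
  have -> : (2 * N - (N - i.+1) = N + i.+1)%N by lia.
  rewrite expr1n mulr1 mulrnAr -mulr_natl Re_natM exprD mulrA -exprMn.
  rewrite [conjc z * z]mulrC zz expr1n mul1r /F; congr (_%:R * _).
  by rewrite -bin_sub; [congr 'C(_, _); lia|lia].
have -> : \sum_(i < N.+1) complex.Re (conjc z ^+ N *
     (z ^+ (2 * N - (N + i)) * 1 ^+ (N + i) *+ 'C(2 * N, N + i))) =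
  \sum_(i < N.+1) F i.
  apply: eq_bigr => i _; have iN := ltn_ord i.
  have -> : (2 * N - (N + i) = N - i)%N by lia.
  rewrite expr1n mulr1 mulrnAr -mulr_natl Re_natM /F; congr (_ * _).
  have {1}-> : N = (i + (N - i))%N by lia.
  rewrite exprD -mulrA -exprMn [conjc z * z]mulrC zz expr1n mulr1.
  exact: Re_conjcX.
rewrite !big_ord_recl /F/= addn0 [RHS]addrCA -big_split/=; congr (_ + _).
by apply: eq_bigr => i _; rewrite natrM /=; ring.
Qed.

End CircleApproximation.

(** * Convolution with the kernel over equidistant nodes *)

Section DiscreteKernel.
Variables (K : realType) (rho : K) (N : nat) (omega : K[i]).
Implicit Types (q : K * K) (u : K * K -> K) (z : K[i]) (j k m : nat).

Local Notation normc := Normc.normc.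

Hypothesis rho_gt0 : 0 < rho.
Hypothesis omega_prim : N.+1.-primitive_root omega.

Let node j : K[i] := rho%:C * omega ^+ j.
Let c k : K := (kernel_coef N k)%:R.
Let c0_gt0 : 0 < c 0%N.
Proof. by rewrite /c ltr0n bin_gt0; lia. Qed.

Lemma normc_root_of_unity j : normc (omega ^+ j) = 1.
Proof.
have o1 : normc omega = 1.
  apply/eqP; rewrite -(@pexpr_eq1 _ (normc omega) N.+1) ?normc_ge0//.
  by rewrite -normcX (prim_expr_order omega_prim) Normc.normc1.
by rewrite normcX o1 expr1n.
Qed.

Let normc_node j : normc (node j) = rho.
Proof.
by rewrite Normc.normcM normc_root_of_unity mulr1 normc_real gtr0_norm.
Qed.

Let node_neq0 j : node j != 0.
Proof.
apply: contraTneq rho_gt0 => nj0.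
by rewrite -(normc_node j) nj0 Normc.normc0 ltxx.
Qed.

Definition node_pt j : K * K := (complex.Re (node j), complex.Im (node j)).

Lemma plane_node_pt j : plane (node_pt j) = node j.
Proof. by rewrite /plane /node_pt; case: (node j). Qed.

Lemma sqnorm_node_pt j : sqnorm (node_pt j) = rho ^+ 2.
Proof.
rewrite -(normc_node j) -plane_node_pt normc_plane sqr_sqrtr//.
exact: sqnorm_ge0.
Qed.

(** The de la Vallee Poussin kernel, unnormalized: on the circle it peaks at the node, with value
    4^N, and decays geometrically in N elsewhere. *)
Definition kernel_at z j : K := normc (1 + z / node j) ^+ 2 ^+ N.

Lemma kernel_at_ge0 z j : 0 <= kernel_at z j.
Proof. by rewrite !exprn_ge0// normc_ge0. Qed.

Lemma kernel_atE z j : normc z = rho ->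
  kernel_at z j = complex.Re (\sum_(k < N.+1) (kernel_coef N k)%:R * (z / node j) ^+ k).
Proof.
move=> zr; rewrite kernelE// Normc.normcM Normc.normcV zr normc_node divff//.
by rewrite gt_eqF.
Qed.

(** The kernel has degree N and there are N + 1 nodes, so each power 1, ..., N sums to zero over the
    roots of unity and only the constant coefficient survives. The discrete total mass is therefore
    exact and independent of z. *)
Lemma sum_kernel_at z : normc z = rho ->
  \sum_(j < N.+1) kernel_at z j = N.+1%:R * c 0%N.
Proof.
move=> zr; under eq_bigr do rewrite kernel_atE//.
rewrite -Re_sum exchange_big/= big_ord_recl [X in _ + X]big1 ?addr0 => [|k _].
  rewrite (eq_bigr (fun=> (kernel_coef N 0)%:R)) => [|j _]; last first.
    by rewrite /= expr0 mulr1.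
  rewrite sumr_const card_ord.
  transitivity (complex.Re (N.+1%:R * c 0%N)%:C); last by [].
  by rewrite rmorphM !rmorph_nat [in RHS]mulr_natl.
rewrite lift0 -mulr_sumr; set S := \sum_(_ < _) _.
suff -> : S = 0 by rewrite mulr0.
pose x := (omega ^+ k.+1)^-1.
have SE : S = (z / rho%:C) ^+ k.+1 * \sum_(j < N.+1) x ^+ j.
  rewrite mulr_sumr; apply: eq_bigr => j _.
  rewrite /node invfM mulrA exprMn; congr (_ * _).
  by rewrite /x -!exprVn -!exprM mulnC.
have xn1 : x != 1.
  rewrite /x invr_eq1 -(prim_order_dvd omega_prim).
  by rewrite gtnNdvd// ltnS ltn_ord.
have : (x - 1) * \sum_(j < N.+1) x ^+ j = 0.
  rewrite -subrX1 /x -exprVn -exprM mulnC exprM exprVn.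
  by rewrite (prim_expr_order omega_prim) invr1 expr1n subrr.
by move/eqP; rewrite mulf_eq0 subr_eq0 (negPf xn1)/= SE => /eqP->; rewrite mulr0.
Qed.

(** Its real part on the circle is the discrete convolution of the boundary values of u with the
    kernel of mass one. The folded coefficients make this the real part of a polynomial, which
    extends it harmonically to the disk. *)
Definition kernel_poly u : {poly K[i]} := \poly_(k < N.+1)
  (((N.+1%:R * c 0%N)^-1)%:C *
   \sum_(j < N.+1) (u (node_pt j))%:C * ((kernel_coef N k)%:R * (node j)^-1 ^+ k)).

Let Mc_gt0 : 0 < N.+1%:R * c 0%N. Proof. by rewrite mulr_gt0. Qed.

Lemma re_kernel_poly u q : sqnorm q = rho ^+ 2 ->
  re_poly (kernel_poly u) q = (N.+1%:R * c 0%N)^-1 *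
    \sum_(j < N.+1) u (node_pt j) * kernel_at (plane q) j.
Proof.
move=> qr; have zr : normc (plane q) = rho.
  by rewrite normc_plane qr sqrtr_sqr gtr0_norm.
under [in RHS]eq_bigr do rewrite kernel_atE// -Re_realM.
rewrite -Re_sum -Re_realM /re_poly /kernel_poly horner_poly; congr (complex.Re _).
under eq_bigr do rewrite -mulrA mulr_suml.
rewrite -mulr_sumr exchange_big/=; congr (_ * _); apply: eq_bigr => j _.
rewrite mulr_sumr; apply: eq_bigr => k _.
by rewrite exprMn; ring.
Qed.

(** A discrete Cauchy estimate: the coefficient is the mean over the nodes of u(node) / node^k,
    times the ratio of kernel coefficients k and 0. That ratio is at most 2, uniformly in N. *)
Lemma kernel_poly_coef_le u (B : K) k :
  (forall q, sqnorm q = rho ^+ 2 -> `|u q| <= B) ->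
  normc (kernel_poly u)`_k * rho ^+ k <= 2 * B.
Proof.
move=> uB; have B0 : 0 <= B := le_trans (normr_ge0 _) (uB _ (sqnorm_node_pt 0)).
rewrite coef_poly; case: ifP => _; last by rewrite Normc.normc0 mul0r mulr_ge0.
rewrite Normc.normcM normc_real gtr0_norm ?invr_gt0//.
rewrite -mulrA -ler_pdivlMl ?invr_gt0// invrK.
have rk0 : 0 < rho ^+ k by rewrite exprn_gt0.
rewrite -ler_pdivlMr//; apply: le_trans (ler_normc_sum _ _ _) _.
apply: (@le_trans _ _ (\sum_(j < N.+1) B * (c k / rho ^+ k))).
  apply: ler_sum => j _; rewrite !Normc.normcM normcX Normc.normcV normc_node.
  rewrite normc_real -(rmorph_nat (real_complex K)) normc_real.
  rewrite (ger0_norm (ler0n K (kernel_coef N k))).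
  rewrite exprVn; apply: ler_wpM2r; last by rewrite uB// sqnorm_node_pt.
  by rewrite divr_ge0 ?ler0n ?(ltW rk0).
rewrite sumr_const card_ord -[X in X <= _]mulr_natl mulrA mulrA.
rewrite ler_pM2r ?invr_gt0//.
have -> : N.+1%:R * c 0%N * (2 * B) = N.+1%:R * B * (2 * c 0%N) by ring.
by rewrite ler_wpM2l ?mulr_ge0// /c -natrM ler_nat kernel_coef_le.
Qed.

(** The parallelogram law |1 + w|^2 + |1 - w|^2 = 4 for |w| = 1, with w = z / node. *)
Lemma kernel_far (d : K) z j : normc z = rho -> 0 <= d ->
  d <= normc (1 - z / node j) -> kernel_at z j <= (4 - d ^+ 2) ^+ N.
Proof.
move=> zr d0 dz; have /normc_unitP : normc (z / node j) = 1.
  by rewrite Normc.normcM Normc.normcV zr normc_node divff// gt_eqF.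
move: dz; rewrite /kernel_at; case: (z / node j) => a b /= dz /eqP.
rewrite eq_complex /= => /andP[/eqP ab _].
have h1 : Num.sqrt ((1 + a) ^+ 2 + (0 + b) ^+ 2) ^+ 2 = (1 + a) ^+ 2 + b ^+ 2.
  by rewrite add0r sqr_sqrtr// addr_ge0 ?sqr_ge0.
have h2 : d ^+ 2 <= (1 - a) ^+ 2 + b ^+ 2.
  have : d ^+ 2 <= Num.sqrt ((1 - a) ^+ 2 + (0 - b) ^+ 2) ^+ 2.
    by rewrite lerXn2r// ?nnegrE ?sqrtr_ge0.
  by rewrite sub0r sqrrN sqr_sqrtr// addr_ge0 ?sqr_ge0.
have le4 : (1 + a) ^+ 2 + b ^+ 2 <= 4 - d ^+ 2 by nra.
have s0 : 0 <= (1 + a) ^+ 2 + b ^+ 2 by rewrite addr_ge0 ?sqr_ge0.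
by rewrite h1 lerXn2r// nnegrE// (le_trans s0).
Qed.

(** Nodes within rho d of q contribute at most h times the kernel mass. At the others u differs by
    at most 2 B and the kernel is at most (4 - d^2)^N; after division by the central binomial, at
    least 4^N / (2N + 1), this is the second error term. *)
Lemma kernel_poly_approx u (B h d : K) q : 0 <= d <= 2 -> 0 <= h ->
  (forall q, sqnorm q = rho ^+ 2 -> `|u q| <= B) ->
  (forall q1 q2, sqnorm q1 = rho ^+ 2 -> sqnorm q2 = rho ^+ 2 ->
     normc (plane q1 - plane q2) < rho * d -> `|u q1 - u q2| <= h) ->
  sqnorm q = rho ^+ 2 ->
  `|u q - re_poly (kernel_poly u) q| <=
    h + 2 * B * (2 * N).+1%:R * (1 - d ^+ 2 / 4) ^+ N.
Proof.
move=> /andP[d0 d2] h0 uB uh qr.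
have B0 : 0 <= B := le_trans (normr_ge0 _) (uB _ qr).
have zr : normc (plane q) = rho.
  by rewrite normc_plane qr sqrtr_sqr gtr0_norm.
rewrite re_kernel_poly//.
have -> : u q = (N.+1%:R * c 0%N)^-1 * \sum_(j < N.+1) u q * kernel_at (plane q) j.
  by rewrite -mulr_sumr sum_kernel_at// mulrC mulfK// gt_eqF.
rewrite -mulrBr -sumrB normrM gtr0_norm ?invr_gt0// ler_pdivrMl//.
apply: le_trans (ler_norm_sum _ _ _) _.
have t0 : 0 <= 4 - d ^+ 2 by nra.
apply: (@le_trans _ _ (\sum_(j < N.+1)
    (h * kernel_at (plane q) j + 2 * B * (4 - d ^+ 2) ^+ N))).
  apply: ler_sum => j _; rewrite -mulrBl normrM (ger0_norm (kernel_at_ge0 _ _)).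
  have k0 := kernel_at_ge0 (plane q) j.
  have B2 : 0 <= 2 * B by rewrite mulr_ge0.
  have [near|far] := ltP (normc (plane q - node j)) (rho * d).
    have ud : `|u q - u (node_pt j)| <= h.
      by apply: uh; rewrite ?sqnorm_node_pt ?plane_node_pt.
    by rewrite ler_wpDr ?mulr_ge0 ?exprn_ge0// ler_wpM2r.
  have ud : `|u q - u (node_pt j)| <= 2 * B.
    apply: le_trans (ler_normB _ _) _.
    have := uB q qr; have := uB _ (sqnorm_node_pt j); lra.
  rewrite ler_wpDl ?mulr_ge0// ler_pM//; apply: kernel_far => //.
  have -> : 1 - plane q / node j = - (plane q - node j) / node j.
    by rewrite opprB mulrBl divff.
  by rewrite Normc.normcM normcN Normc.normcV normc_node ler_pdivlMr// mulrC.
rewrite big_split/= -mulr_sumr sum_kernel_at// sumr_const card_ord.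
rewrite -[X in _ + X]mulr_natl.
suff key : 2 * B * (4 - d ^+ 2) ^+ N <=
    c 0%N * (2 * B * (2 * N).+1%:R * (1 - d ^+ 2 / 4) ^+ N).
  rewrite mulrDr [h * _]mulrC lerD2l -[leRHS]mulrA.
  by apply: ler_wpM2l.
have -> : (4 - d ^+ 2) ^+ N = 4 ^+ N * (1 - d ^+ 2 / 4) ^+ N.
  by rewrite -exprMn; congr (_ ^+ N); field.
have -> : 2 * B * (4 ^+ N * (1 - d ^+ 2 / 4) ^+ N) =
  (2 * B * (1 - d ^+ 2 / 4) ^+ N) * 4 ^+ N by ring.
have -> : c 0%N * (2 * B * (2 * N).+1%:R * (1 - d ^+ 2 / 4) ^+ N) =
  (2 * B * (1 - d ^+ 2 / 4) ^+ N) * ((2 * N).+1%:R * c 0%N) by ring.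
rewrite ler_wpM2l ?mulr_ge0 ?exprn_ge0//; first by nra.
by rewrite /c -natrM -natrX ler_nat expn4_le_central.
Qed.

End DiscreteKernel.

Section HarmonicApproximation.
Variable K : realType.
Implicit Types (q : K * K) (u : K * K -> K).

Local Notation normc := Normc.normc.

Lemma bernoulli_le (a : K) m : 0 <= a -> 1 + m%:R * a <= (1 + a) ^+ m.
Proof.
move=> a0; elim: m => [|m IH]; first by rewrite mul0r addr0 expr0.
rewrite exprS; have : 0 <= m%:R * a by rewrite mulr_ge0.
by rewrite -natr1; nra.
Qed.

(** Bernoulli gives x^m <= 1 / (m a) with a = 1/x - 1. An even exponent N = 2 m squares this, and
    the resulting 1/m^2 beats the linear factor. *)
Lemma linear_times_geometric_small (x C e : K) : 0 < x < 1 -> 0 <= C -> 0 < e ->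
  exists N, C * (2 * N).+1%:R * x ^+ N <= e.
Proof.
move=> /andP[x0 x1] C0 e0; pose a := x^-1 - 1.
have a0 : 0 < a by rewrite subr_gt0 invf_gt1.
pose m := (Num.truncn (5 * C / (a ^+ 2 * e))).+1.
have mgt : 5 * C / (a ^+ 2 * e) <= m%:R.
  by apply: ltW; rewrite /m truncnS_gt.
have m1 : 1 <= m%:R :> K by rewrite ler1n.
exists (2 * m)%N.
have xm : x ^+ m * (m%:R * a) <= 1.
  have xa1 : x ^+ m * (1 + a) ^+ m = 1.
    by rewrite /a addrC subrK -exprMn mulfV ?expr1n ?gt_eqF.
  rewrite -[leRHS]xa1.
  apply: ler_wpM2l; first by rewrite exprn_ge0 ?(ltW x0).
  by have := bernoulli_le m (ltW a0); lra.
have ma0 : 0 < m%:R * a by rewrite mulr_gt0// (lt_le_trans ltr01).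
have xm' : x ^+ m <= (m%:R * a)^-1 by rewrite -[leRHS]mul1r ler_pdivlMr.
have x2m : x ^+ (2 * m) <= (m%:R * a)^-1 ^+ 2.
  rewrite mulnC exprM lerXn2r// ?nnegrE ?exprn_ge0 ?(ltW x0)//.
  by rewrite invr_ge0 ltW.
have c5 : (2 * (2 * m)).+1%:R <= 5 * m%:R :> K.
  by rewrite -natrM ler_nat; lia.
apply: (@le_trans _ _ (C * (5 * m%:R) * (m%:R * a)^-1 ^+ 2)).
  by rewrite ler_pM ?mulr_ge0 ?exprn_ge0 ?(ltW x0)// ler_wpM2l.
have m_neq0 : m%:R != 0 :> K by rewrite gt_eqF// (lt_le_trans ltr01).
have a_neq0 : a != 0 by rewrite gt_eqF.
have -> : C * (5 * m%:R) * (m%:R * a)^-1 ^+ 2 = 5 * C / (a ^+ 2) / m%:R.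
  by field; rewrite m_neq0 a_neq0.
rewrite ler_pdivrMr ?(lt_le_trans ltr01)//.
have a2_gt0 : 0 < a ^+ 2 by rewrite exprn_gt0.
rewrite ler_pdivrMr//; move: mgt; rewrite ler_pdivrMr ?mulr_gt0//.
by have -> : e * m%:R * a ^+ 2 = m%:R * (a ^+ 2 * e) by ring.
Qed.

Lemma uniform_continuity_circle u (r2 h : K) : continuous u -> 0 < h ->
  exists2 d : K, 0 < d & forall q1 q2, sqnorm q1 = r2 -> sqnorm q2 = r2 ->
    sqnorm (q1 - q2) < d -> `|u q1 - u q2| <= h.
Proof.
move=> cu h0.
(* The squared distance attains a positive minimum on the compact set of pairs of
   points of the circle where [u] differs by at least [h]. *)
pose D := [set x : (K * K) * (K * K) |
  [/\ sqnorm x.1 = r2, sqnorm x.2 = r2 & h <= `|u x.1 - u x.2|]].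
have [[x0 Dx0]|D0] := pselect (D !=set0); last first.
  exists 1 => // q1 q2 h1 h2 _; rewrite leNgt; apply/negP => hu.
  by apply: D0; exists (q1, q2); split=> //; exact: ltW.
have cfst : continuous (fst : (K * K) * (K * K) -> K * K).
  by move=> x; apply: cvg_fst.
have csnd : continuous (snd : (K * K) * (K * K) -> K * K).
  by move=> x; apply: cvg_snd.
have cD : compact D.
  pose C := [set q : K * K | r2 <= sqnorm q <= r2].
  apply: (@subclosed_compact _ _ (C `*` C)).
  - have -> : D = (@sqnorm K \o fst) @^-1` [set r2] `&`
       (@sqnorm K \o snd) @^-1` [set r2] `&`
       (fun x => `|u x.1 - u x.2|) @^-1` [set y | h <= y].
      by apply/seteqP; split=> x /=; [case|case=> [[]]].
    apply: closedI; first apply: closedI.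
    + apply: closed_comp => [x _|]; last exact: closed_eq.
      by apply: continuous_comp; [exact: cfst|exact: continuous_sqnorm].
    + apply: closed_comp => [x _|]; last exact: closed_eq.
      by apply: continuous_comp; [exact: csnd|exact: continuous_sqnorm].
    + apply: closed_comp => [x _|]; last exact: closed_ge.
      apply: cvg_norm; apply: cvgB.
        by apply: (@continuous_comp _ _ _ fst u); [exact: cfst|exact: cu].
      by apply: (@continuous_comp _ _ _ snd u); [exact: csnd|exact: cu].
  - by apply: compact_setX; exact: compact_sqnorm.
  - by move=> x [h1 h2 _]; split; rewrite /C/= ?h1 ?h2 lexx.
pose g (x : (K * K) * (K * K)) := sqnorm (x.1 - x.2).
have cg : continuous g.
  have cB : continuous (fun x : (K * K) * (K * K) => x.1 - x.2).
    by move=> x; apply: cvgB; [exact: cfst|exact: csnd].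
  have -> : g = @sqnorm K \o (fun x : (K * K) * (K * K) => x.1 - x.2) by [].
  by move=> x; apply: continuous_comp; [exact: cB|exact: continuous_sqnorm].
have [x /set_mem[x1 x2 xh] x_min] : exists2 c, c \in D &
    forall t, t \in D -> g c <= g t.
  by apply: compact_EVT_min => //; [exists x0|exact: continuous_subspaceT].
exists (g x).
  rewrite lt_def sqnorm_ge0 andbT; apply/negP => /eqP gx0.
  have E : x.1 = x.2.
    move: gx0; rewrite /g /sqnorm => /eqP.
    rewrite paddr_eq0 ?sqr_ge0// !sqrf_eq0 /= !subr_eq0 => /andP[/eqP e1 /eqP e2].
    by apply: injective_projections.
  by move: xh; rewrite E subrr normr0 leNgt h0.
move=> q1 q2 h1 h2 lt; rewrite leNgt; apply/negP => hu.
have : g x <= g (q1, q2) by apply: x_min; apply: mem_set; split=> //; exact: ltW.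
by rewrite leNgt /g /= lt.
Qed.

(** The kernel polynomial is close to u on the circle; the maximum principle, applied to u - Re P
    and to its opposite, carries the estimate into the disk. The coefficient bound does not depend
    on eta, which allows eta to tend to 0 later. *)
Lemma harmonic_approximation u (rho B eta : K) : 0 < rho -> 0 < eta ->
  C_k 2 u -> (forall q, sqnorm q < rho ^+ 2 -> real_laplacian u q = 0) ->
  (forall q, sqnorm q = rho ^+ 2 -> `|u q| <= B) ->
  exists2 P : {poly K[i]},
    forall k, normc P`_k * rho ^+ k <= 2 * B &
    forall q, sqnorm q <= rho ^+ 2 -> `|u q - re_poly P q| <= eta.
Proof.
move=> rho0 eta0 C2 lap0 uB; have cu := C_k_continuous C2.
have eta2 : 0 < eta / 2 by rewrite divr_gt0.
have [d d0 ud] := uniform_continuity_circle (rho ^+ 2) cu eta2.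
(* The cap 1 keeps the ratio 1 - d'^2 / 4 strictly between 0 and 1; the other term converts a
   squared distance d into a distance relative to rho. *)
pose d' := Num.min 1 (Num.sqrt d / rho).
have d'_gt0 : 0 < d' by rewrite lt_min ltr01 divr_gt0// sqrtr_gt0.
have d'_le1 : d' <= 1 by rewrite ge_min lexx.
have B0 : 0 <= B.
  have := uB (rho, 0); rewrite /sqnorm /= expr0n/= addr0 => /(_ erefl).
  exact: le_trans.
have x01 : 0 < 1 - d' ^+ 2 / 4 < 1.
  have : d' ^+ 2 <= 1 by rewrite expr_le1// ltW.
  have : 0 < d' ^+ 2 by rewrite exprn_gt0.
  by move=> ? ?; apply/andP; split; lra.
have [N NP] := linear_times_geometric_small x01 (mulr_ge0 (ler0n _ 2) B0) eta2.
have [omega om] := @exists_primitive_root K[i] N.+1 isT.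
pose P := kernel_poly rho N omega u.
exists P; first by move=> k; exact: kernel_poly_coef_le.
have circ q : sqnorm q = rho ^+ 2 -> `|u q - re_poly P q| <= eta.
  move=> qr; have d'02 : 0 <= d' <= 2 by rewrite (ltW d'_gt0)/=; lra.
  apply: le_trans (kernel_poly_approx rho0 om d'02 (ltW eta2) uB _ qr) _.
    move=> q1 q2 h1 h2 lt; apply: ud => //.
    have s0 := sqnorm_ge0 (q1 - q2).
    have E : plane q1 - plane q2 = plane (q1 - q2) by [].
    move: lt; rewrite E normc_plane => lt.
    rewrite -(sqr_sqrtr s0) -(sqr_sqrtr (ltW d0)).
    rewrite ltr_pXn2r// ?nnegrE ?sqrtr_ge0//.
    apply: lt_le_trans lt _; rewrite mulrC -ler_pdivlMr//.
    by rewrite ge_min lexx orbT.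
  by move: NP; lra.
pose U := [set q : K * K | -1 < sqnorm q < rho ^+ 2].
pose D := [set q : K * K | 0 <= sqnorm q <= rho ^+ 2].
have lapP : laplacian_on U (u \+ -1 \*: re_poly P) (fun=> 0).
  have [wx [wy [wxx [wyy H]]]] := laplacian_onD (laplacian_on_C2 U C2)
    (laplacian_onZ (-1) (laplacian_on_re_poly U P)).
  exists wx, wy, wxx, wyy => q Uq; have [? ? ? ? ->] := H q Uq; split=> //.
  rewrite /= lap0 ?add0r; first by rewrite scaler0.
  by case/andP: Uq.
have cw : continuous (u \+ -1 \*: re_poly P).
  move=> q; apply: cvgD; first exact: cu.
  by apply: cvgZl_tmp; exact: (continuous_re_im_poly P).1.
have wE q : (u \+ -1 \*: re_poly P) q = u q - re_poly P q.
  by rewrite /= scaleN1r.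
have bdry q : D q -> ~ U q -> sqnorm q = rho ^+ 2.
  move=> /andP[_ qr] nU; apply/eqP; rewrite eq_le qr leNgt; apply/negP => lt.
  by apply: nU; rewrite /U/= lt andbT (lt_le_trans _ (sqnorm_ge0 q))// oppr_lt0.
have UD : U `<=` D.
  by move=> q /andP[_ /ltW lt]; rewrite /D/= lt sqnorm_ge0.
move=> q qr; have Dq : D q by rewrite /D/= sqnorm_ge0.
rewrite ler_norml; apply/andP; split; last first.
  rewrite -wE; apply: (@max_principle K D U _ _ _ _ _ UD _ lapP) => //.
  - exact: compact_sqnorm.
  - exact: open_sqnorm.
  - exact: continuous_subspaceT.
  - move=> p Dp nUp; rewrite wE; apply: le_trans (ler_norm _) _.
    by apply: circ; exact: bdry.
rewrite lerNl -wE -[leLHS]scaleN1r.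
have lapN : laplacian_on U (-1 \*: (u \+ -1 \*: re_poly P)) (fun=> 0).
  have [wx [wy [wxx [wyy H]]]] := laplacian_onZ (-1) lapP.
  exists wx, wy, wxx, wyy => p Up; have [? ? ? ? ->] := H p Up; split=> //.
  by rewrite /= scaler0.
apply: (@max_principle K D U (-1 \*: (u \+ -1 \*: re_poly P)) _ _ _ _ UD _ lapN) => //.
- exact: compact_sqnorm.
- exact: open_sqnorm.
- by apply: continuous_subspaceT => p; apply: cvgZl_tmp; exact: cw.
- move=> p Dp nUp; rewrite [leLHS]scaleN1r wE; apply: le_trans (ler_norm _) _.
  by rewrite normrN; apply: circ; exact: bdry.
Qed.

End HarmonicApproximation.
(** * The main estimate *)

Section EssentialSupremum.
Variable K : realType.
Local Open Scope ereal_scope.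

Local Notation mu2 := (@lebesgue_measure K \x @lebesgue_measure K).

Lemma measure_box_gt0 (p : K * K) (r : K) : (0 < r)%R ->
  0 < mu2 (`](p.1 - r)%R, (p.1 + r)%R[%classic `*` `](p.2 - r)%R, (p.2 + r)%R[%classic).
Proof.
move=> r0; rewrite product_measure1E//; try exact: measurable_itv.
have itv_gt0 (x : K) :
    0 < lebesgue_measure (`](x - r)%R, (x + r)%R[%classic : set K).
  rewrite lebesgue_measure_itv/= lte_fin ifT; last by lra.
  by rewrite -EFinD lte_fin; lra.
by apply: mule_gt0; exact: itv_gt0.
Qed.

(** If f(p) exceeded the essential supremum, f would do so on a whole box around p by continuity,
    and a box has positive measure. The Laplacian is thereby bounded at every point. *)
Lemma le_Linfty_of_continuous (f : K * K -> K) p : continuous f ->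
  (f p)%:E <= Lnorm mu2 +oo (fun q => (f q)%:E).
Proof.
move=> cf.
(* The norm of exponent +oo is the essential supremum only on a space of positive measure. *)
have muT : 0 < mu2 [set: K * K].
  apply: lt_le_trans (measure_box_gt0 p ltr01) _.
  apply: le_measure; rewrite ?inE//; apply: measurableX; exact: measurable_itv.
rewrite unlock /= muT leNgt; apply/negP => lt.
set s := ess_sup _ _ in lt.
have [N [mN N0 sN]] := ess_sup_ge mu2 (abse \o (fun q => (f q)%:E)).
have s_ge0 : 0 <= s by apply: ess_sup_gee => //; apply: nearW => q /=.
have s_fin : s \is a fin_num.
  by rewrite ge0_fin_numE//; apply: lt_trans lt _; exact: ltry.
have fs : (fine s < f p)%R by rewrite -lte_fin fineK.
have : \forall q \near p, (fine s < f q)%R by apply: (cvgr_gt _ (cf p)).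
move=> /nbhs_ballP[r /= r0 br].
have box_sub : `](p.1 - r)%R, (p.1 + r)%R[%classic `*` `](p.2 - r)%R, (p.2 + r)%R[%classic `<=` N.
  move=> q [/= q1 q2]; apply: sN => /= qs.
  have : (fine s < f q)%R.
    apply: br; split; rewrite /ball/=.
      by move: q1; rewrite in_itv/= => /andP[? ?]; rewrite ltr_norml; apply/andP; split; lra.
    by move: q2; rewrite in_itv/= => /andP[? ?]; rewrite ltr_norml; apply/andP; split; lra.
  rewrite -lte_fin fineK// => h; have : s < s; last by rewrite ltxx.
  by apply: lt_le_trans h (le_trans _ qs); rewrite lee_fin ler_norm.
have : 0 < mu2 N.
  apply: lt_le_trans (measure_box_gt0 p r0) _.
  by apply: le_measure; rewrite ?inE//; apply: measurableX; exact: measurable_itv.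
by rewrite [X in 0 < X]N0 ltxx.
Qed.

End EssentialSupremum.

(** * From power sums to sums of harmonic functions *)

Section PowerSums.
Variable K : realType.
Implicit Types (q : K * K) (u : K * K -> K) (z : K[i]).

Local Notation normc := Normc.normc.

Definition point z : K * K := (complex.Re z, complex.Im z).

Lemma pointK z : plane (point z) = z. Proof. by case: z. Qed.

Lemma sqnorm_point z : sqnorm (point z) = normc z ^+ 2.
Proof. by rewrite -{2}[z]pointK normc_plane sqr_sqrtr// sqnorm_ge0. Qed.

(** Expanding P turns the difference into coefficients times differences of power sums. Degree 0
    cancels because both families have n members; in degree k the bound 2 B 5^k meets the weight in
    T, once for each family. *)
Lemma sum_re_poly_le n (l1 l2 : 'I_n -> K[i]) (P : {poly K[i]}) (B T : K) :
  (forall k, normc P`_k * 5^-1 ^+ k <= 2 * B) ->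
  (forall N, \sum_(k < N) 5 ^+ k.+1 * normc (\sum_i l1 i ^+ k.+1) <= T) ->
  (forall N, \sum_(k < N) 5 ^+ k.+1 * normc (\sum_i l2 i ^+ k.+1) <= T) ->
  `|\sum_(i < n) (re_poly P (point (l1 i))
                  - re_poly P (point (l2 i)))| <= 4 * B * T.
Proof.
move=> PB T1 T2.
have P_le k : normc P`_k <= 2 * B * 5 ^+ k.
  by have := PB k; rewrite exprVn ler_pdivrMr ?exprn_gt0.
have B0 : 0 <= 2 * B.
  by apply: le_trans (PB 0); rewrite expr0 mulr1 normc_ge0.
have T0 : 0 <= T by have := T1 0; rewrite big_ord0.
have -> : \sum_(i < n) (re_poly P (point (l1 i))
                  - re_poly P (point (l2 i))) =
  complex.Re (\sum_(k < size P)
    P`_k * (\sum_i l1 i ^+ k - \sum_i l2 i ^+ k)).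
  have E (l : 'I_n -> K[i]) : \sum_(k < size P) P`_k * (\sum_i l i ^+ k) =
      \sum_i P.[l i].
    under [RHS]eq_bigr do rewrite horner_coef.
    by rewrite exchange_big; apply: eq_bigr => k _; rewrite mulr_sumr.
  under [in RHS]eq_bigr do rewrite mulrBr.
  rewrite [in RHS]sumrB !E -[in RHS]sumrB Re_sum; apply: eq_bigr => i _.
  by rewrite /re_poly !pointK; case: (P.[_]) (P.[_]) => [? ?] [].
apply: le_trans (ler_normRe_normc _) _; apply: le_trans (ler_normc_sum _ _ _) _.
case: (size P) => [|N]; first by rewrite big_ord0 mulr_ge0//; lra.
have E0 : \sum_i l1 i ^+ (ord0 : 'I_N.+1) - \sum_i l2 i ^+ (ord0 : 'I_N.+1) = 0.
  by apply/eqP; rewrite subr_eq0; apply/eqP/eq_bigr.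
rewrite big_ord_recl E0 mulr0 Normc.normc0 add0r.
apply: (@le_trans _ _ (\sum_(k < N) (2 * B * (5 ^+ k.+1 * normc (\sum_i l1 i ^+ k.+1))
                       + 2 * B * (5 ^+ k.+1 * normc (\sum_i l2 i ^+ k.+1))))).
  apply: ler_sum => k _; rewrite lift0 Normc.normcM -!mulrDr mulrA.
  rewrite ler_pM ?normc_ge0 ?P_le//.
  by apply: le_trans (ler_normcD _ _) _; rewrite normcN.
have h1 := ler_wpM2l B0 (T1 N); rewrite mulr_sumr in h1.
have h2 := ler_wpM2l B0 (T2 N); rewrite mulr_sumr in h2.
have -> : 4 * B * T = 2 * B * T + 2 * B * T by ring.
apply: le_trans (lerD h1 h2).
rewrite -big_split.
exact: lexx.
Qed.

Lemma sub_split (a b c d : K) : a - b = (c - d) + ((a - c) - (b - d)).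
Proof. by ring. Qed.

Lemma sum_harmonic_le n (l1 l2 : 'I_n -> K[i]) u (B T : K) :
  C_k 2 u -> (forall q, sqnorm q < 5^-1 ^+ 2 -> real_laplacian u q = 0) ->
  (forall q, sqnorm q = 5^-1 ^+ 2 -> `|u q| <= B) ->
  (forall i : 'I_n, normc (l1 i) < 5^-1) ->
  (forall i : 'I_n, normc (l2 i) < 5^-1) ->
  (forall N, \sum_(k < N) 5 ^+ k.+1 * normc (\sum_i l1 i ^+ k.+1) <= T) ->
  (forall N, \sum_(k < N) 5 ^+ k.+1 * normc (\sum_i l2 i ^+ k.+1) <= T) ->
  `|\sum_(i < n) (u (point (l1 i))
                  - u (point (l2 i)))| <= 4 * B * T.
Proof.
move=> C2 lap0 uB ev1 ev2 T1 T2; apply/ler_addgt0Pr => e e0.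
(* Each of the n terms costs at most 2 eta; [n.+1] keeps the denominator nonzero for n = 0. *)
pose eta := e / (2 * n.+1%:R).
have n1 : 0 < n.+1%:R :> K by rewrite ltr0n.
have eta0 : 0 < eta by rewrite divr_gt0// mulr_gt0.
have r0 : 0 < 5^-1 :> K by rewrite invr_gt0.
have [P PB Pu] := harmonic_approximation r0 eta0 C2 lap0 uB.
have Pu' z : normc z < 5^-1 -> `|u (point z) - re_poly P (point z)| <= eta.
  move=> zr; apply: Pu; rewrite sqnorm_point lerXn2r// ?nnegrE ?normc_ge0 ?ltW//.
pose D (l : 'I_n -> K[i]) (i : 'I_n) := u (point (l i)) - re_poly P (point (l i)).
have -> : \sum_(i < n) (u (point (l1 i))
                  - u (point (l2 i))) =
  \sum_(i < n) (re_poly P (point (l1 i))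
                  - re_poly P (point (l2 i)))
  + \sum_(i < n) (D l1 i - D l2 i).
  rewrite -big_split; apply: eq_bigr => i _; exact: sub_split.
apply: le_trans (ler_normD _ _) _; apply: lerD.
  exact: sum_re_poly_le.
apply: le_trans (ler_norm_sum _ _ _) _.
apply: (@le_trans _ _ (\sum_(i < n) 2 * eta)).
  apply: ler_sum => i _; apply: le_trans (ler_normB _ _) _.
  by rewrite mulr_natl mulr2n lerD// Pu'.
rewrite sumr_const card_ord -[X in X <= _]mulr_natl.
have -> : e = n.+1%:R * (2 * eta).
  by rewrite /eta; field; rewrite gt_eqF.
apply: ler_wpM2r; first by rewrite mulr_ge0// ltW.
by rewrite ler_nat.
Qed.

Lemma real_sum_bound n (l1 l2 : 'I_n -> K[i]) u (L delta : K) :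
  C_k 3 u ->
  (forall q, sqnorm q < 5^-1 ^+ 2 -> real_laplacian u q = 0) ->
  (forall q, `|real_laplacian u q| <= L) ->
  (forall q, 4^-1 ^+ 2 <= sqnorm q -> u q = 0) ->
  delta <= 3^-1 -> n%:R * delta <= 20 -> 0 <= delta ->
  let s := 25 / 16 * delta in
  (forall i : 'I_n, normc (l1 i) < 5^-1) ->
  (forall i : 'I_n, normc (l2 i) < 5^-1) ->
  (forall N, \sum_(k < N) 5 ^+ k.+1 * normc (\sum_i l1 i ^+ k.+1) <=
     n%:R * (s / (1 - s))) ->
  (forall N, \sum_(k < N) 5 ^+ k.+1 * normc (\sum_i l2 i ^+ k.+1) <=
     n%:R * (s / (1 - s))) ->
  `|\sum_(i < n) (u (point (l1 i))
                  - u (point (l2 i)))| <= 3 / 2 * L.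
Proof.
move=> C3 lap0 lapL u0 d3 nd d0 s ev1 ev2 T1 T2; have C2 := C_kW C3.
have L0 : 0 <= L := le_trans (normr_ge0 _) (lapL (0, 0)).
(* The barrier on the disk of radius 1/4, on whose boundary u vanishes, evaluated at |z| = 1/5 for u
   and for -u: (1/16 - 1/25) / 4 = 9/1600. *)
have uB q : sqnorm q = 5^-1 ^+ 2 -> `|u q| <= 9 / 1600 * L.
  move=> qr; have qle : sqnorm q <= 4^-1 ^+ 2 by rewrite qr; lra.
  have lap_u := laplacian_on_C2 setT C2.
  have cu := C_k_continuous C2.
  have up : u q <= L / 4 * (4^-1 ^+ 2 - sqnorm q).
    apply: (le_of_laplacian_ge cu lap_u) => // p pr; last by rewrite u0 ?pr.
    by have := lapL p; rewrite ler_norml => /andP[].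
  have un : (-1 \*: u) q <= L / 4 * (4^-1 ^+ 2 - sqnorm q).
    have cN : continuous (-1 \*: u) by move=> p; apply: cvgZl_tmp; exact: cu.
    apply: (le_of_laplacian_ge cN (laplacian_onZ (-1) lap_u)) => // p pr.
      rewrite [leRHS]scaleN1r lerN2.
      by have := lapL p; rewrite ler_norml => /andP[].
    by rewrite [leLHS]scaleN1r u0 ?pr// oppr0.
  move: up un; rewrite qr /= scaleN1r ler_norml => up un.
  by apply/andP; split; lra.
apply: le_trans (sum_harmonic_le C2 lap0 uB ev1 ev2 T1 T2) _.
have s1 : 23 / 48 <= 1 - s by rewrite /s; lra.
(* n s <= (25/16) 20 = 125/4, and (125/4) (48/23) < 66. Then 4 (9/1600) 66 = 1.485 < 3/2. *)
have sT : n%:R * (s / (1 - s)) <= 66.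
  rewrite mulrA ler_pdivrMr; last by lra.
  by rewrite /s; lra.
have := ler_wpM2l L0 sT; lra.
Qed.

End PowerSums.

(** * Real and imaginary parts of the test function *)

Section TestFunctions.
Variables (K : realType) (phi : K[i] -> K[i]).
Implicit Types (q : K * K) (z : K[i]).

Local Notation normc := Normc.normc.

Hypotheses (phi_smooth : smooth phi) (phi_compact : compact (csupport phi)).

Lemma Re_part_point z : Re_part phi (point z) = complex.Re (phi z).
Proof. by rewrite /Re_part pointK. Qed.

Lemma Im_part_point z : Im_part phi (point z) = complex.Im (phi z).
Proof. by rewrite /Im_part pointK. Qed.

Lemma csupport_out (f : K[i] -> K[i]) q : ~ csupport f q -> f (plane q) = 0.
Proof.
move=> nq; apply/eqP/negPn/negP => fq.
by apply: nq; apply: subset_closure.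
Qed.

Lemma csupport_bounded : exists b : K, forall q, b < sqnorm q ->
  Re_part phi q = 0 /\ Im_part phi q = 0.
Proof.
have [[p0 p0C]|C0] := pselect (csupport phi !=set0); last first.
  exists 0 => q _; rewrite /Re_part /Im_part csupport_out//.
  by move=> qC; apply: C0; exists q.
have [c _ c_max] : exists2 c, c \in csupport phi &
    forall q, q \in csupport phi -> sqnorm q <= sqnorm c.
  apply: compact_EVT_max => //; first by exists p0.
  exact/continuous_subspaceT/continuous_sqnorm.
exists (sqnorm c) => q cq; rewrite /Re_part /Im_part csupport_out//.
by move=> /mem_set/c_max; rewrite leNgt cq.
Qed.

Lemma laplacian_plane q : laplacian phi (plane q) =
  real_laplacian (Re_part phi) q +i* real_laplacian (Im_part phi) q.
Proof. by case: q. Qed.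

Lemma real_laplacian_out q : ~ csupport (laplacian phi) q ->
  real_laplacian (Re_part phi) q = 0 /\ real_laplacian (Im_part phi) q = 0.
Proof. by move=> /csupport_out; rewrite laplacian_plane => -[-> ->]. Qed.

Section LaplacianInDisk.
Hypothesis lap_disk :
  csupport (laplacian phi) `<=` [set p | normc (plane p) < 4^-1].

Lemma parts_eq0_outside q : 4^-1 ^+ 2 <= sqnorm q ->
  Re_part phi q = 0 /\ Im_part phi q = 0.
Proof.
move=> q4; have [b bP] := csupport_bounded; have [C_Re C_Im] := phi_smooth 3.
have a0 : 0 <= 4^-1 ^+ 2 :> K by rewrite exprn_ge0.
have out p : 4^-1 ^+ 2 <= sqnorm p -> ~ csupport (laplacian phi) p.
  move=> p4 /lap_disk lt; have {}lt : Num.sqrt (sqnorm p) < 4^-1 := lt.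
  have : Num.sqrt (4^-1 ^+ 2) <= Num.sqrt (sqnorm p) by rewrite ler_wsqrtr.
  by rewrite sqrtr_sqr gtr0_norm// leNgt lt.
have lap0 p (p4 : 4^-1 ^+ 2 <= sqnorm p) := real_laplacian_out (out p p4).
split.
  exact: (eq0_outside C_Re a0 (fun p h => (lap0 p h).1) (fun p h => (bP p h).1) q4).
exact: (eq0_outside C_Im a0 (fun p h => (lap0 p h).2) (fun p h => (bP p h).2) q4).
Qed.

Lemma phi_eq0_outside z : 4^-1 <= normc z -> phi z = 0.
Proof.
move=> z4; have [] := @parts_eq0_outside (point z).
  by rewrite sqnorm_point lerXn2r ?nnegrE ?normc_ge0.
rewrite Re_part_point Im_part_point => Re0 Im0.
by apply/eqP; rewrite eq_complex Re0 Im0 !eqxx.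
Qed.

End LaplacianInDisk.

Lemma continuous_normc_laplacian :
  continuous (fun q => normc (laplacian phi (plane q))).
Proof.
have [C_Re C_Im] := phi_smooth 2.
have cont f : C_k 2 f -> continuous (fun q : K * K => real_laplacian f q ^+ 2).
  move=> C2 q; have [Cx Cy] := C_k_partial C2.
  have [/C_k_continuous cxx _] := C_k_partial Cx.
  have [_ /C_k_continuous cyy] := C_k_partial Cy.
  have cl : {for q, continuous (real_laplacian f)}.
    by apply: cvgD; [exact: cxx|exact: cyy].
  apply: (@continuous_comp _ _ _ (real_laplacian f) (fun x : K => x ^+ 2)) => //.
  exact: exprn_continuous.
have -> : (fun q => normc (laplacian phi (plane q))) = Num.sqrt \o
   (fun q => real_laplacian (Re_part phi) q ^+ 2 + real_laplacian (Im_part phi) q ^+ 2).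
  by apply/funext => q; rewrite laplacian_plane.
move=> q; apply: continuous_comp; last exact: sqrt_continuous.
by apply: cvgD; [exact: cont C_Re q|exact: cont C_Im q].
Qed.

Lemma normc_laplacian_le q :
  ((normc (laplacian phi (plane q)))%:E <= Linfty_norm (laplacian phi))%E.
Proof.
exact: (le_Linfty_of_continuous q continuous_normc_laplacian).
Qed.

End TestFunctions.

Lemma normc_sum_parts_le (K : realType) n (phi : K[i] -> K[i])
    (l1 l2 : 'I_n -> K[i]) (B : K) :
  `|\sum_i (Re_part phi (point (l1 i)) - Re_part phi (point (l2 i)))| <= B ->
  `|\sum_i (Im_part phi (point (l1 i)) - Im_part phi (point (l2 i)))| <= B ->
  Normc.normc (\sum_i (phi (l1 i) - phi (l2 i))) <= B + B.
Proof.
have Re_sub (x y : K[i]) : complex.Re (x - y) = complex.Re x - complex.Re y.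
  by case: x y => [? ?] [].
have Im_sub (x y : K[i]) : complex.Im (x - y) = complex.Im x - complex.Im y.
  by case: x y => [? ?] [].
have Im_sum (F : 'I_n -> K[i]) :
    complex.Im (\sum_i F i) = \sum_i complex.Im (F i).
  by elim/big_ind2: _ => // x1 x2 y1 y2 <- <-; exact: Im_addc.
move=> ReB ImB; apply: le_trans (normc_le_ReIm _) (lerD _ _).
  apply: le_trans ReB; rewrite le_eqVlt; apply/orP; left; apply/eqP.
  rewrite Re_sum; congr (`|_|); apply: eq_bigr => i _.
  by rewrite Re_sub !Re_part_point.
apply: le_trans ImB; rewrite le_eqVlt; apply/orP; left; apply/eqP.
rewrite Im_sum; congr (`|_|); apply: eq_bigr => i _.
by rewrite Im_sub !Im_part_point.
Qed.
Theorem proposition5p2 (K : realType) (n : nat) (gamma : K) (R : 'M[K[i]]_n)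
    (n_gt0 : (0 < n)%N) (gamma_gt0 : 0 < gamma)
    (R_entries : forall i j : 'I_n,
       R i j = (n%:R `^ (- gamma))%:C \/ R i j = - (n%:R `^ (- gamma))%:C) :
  let J : 'M[K[i]]_n := superdiag_mx K[i] n in
  let P : 'M[K[i]]_n := corner_mx n (n%:R `^ (- gamma))%:C in
  (n%:R <= (gamma * ln gamma - ln 3) / ln 5 -> (7 <= n)%N ->
   forall phi : K[i] -> K[i], smooth phi -> compact (csupport phi) ->
   csupport (laplacian phi) `<=`
     [set p | 5^-1 <= Normc.normc (plane p) < 4^-1] ->
   ((Normc.normc (\sum_(i < n) (phi (eigenvalues (J + R))`_i
                               - phi (eigenvalues (J + P))`_i)))%:E
    <= 3%:E * Linfty_norm (laplacian phi))%E)
  /\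
  (2 * gamma * ln gamma <= n%:R -> 5 <= gamma ->
   forall phi : K[i] -> K[i], smooth phi -> compact (csupport phi) ->
   csupport (laplacian phi) `<=` [set p | Normc.normc (plane p) < 4^-1] ->
   ((Normc.normc (\sum_(i < n) phi (eigenvalues (J + R))`_i))%:E
    <= 3%:E * Linfty_norm (laplacian phi))%E).
Proof.
move=> J P; set eps : K := n%:R `^ (- gamma).
have eps_gt0 : 0 < eps by rewrite powR_gt0// ltr0n.
have R_eq i j : Normc.normc (R i j) = eps.
  have := normc_real eps; rewrite (gtr0_norm eps_gt0) => epsN.
  by case: (R_entries i j) => ->; rewrite ?normcN.
have R_le i j : Normc.normc (R i j) <= eps by rewrite R_eq.
have P_le i j : Normc.normc (P i j) <= eps.
  rewrite mxE; case: ifP => _; last by rewrite Normc.normc0 ltW.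
  by rewrite normc_real gtr0_norm.
have powerE (M : 'M[K[i]]_n) k :
    \sum_(i < n) (eigenvalues M)`_i ^+ k = \tr (M ^+ k).
  exact: sum_eigenvaluesX.
split=> [n_le n_ge7 phi sm cpt sub | n_ge g5 phi sm cpt sub].
  have d3 := delta_le gamma_gt0 n_ge7 n_le.
  have nd := n_delta_le gamma_gt0 n_ge7 n_le.
  rewrite -/eps in d3 nd; set delta := 5 ^+ n * eps in d3 nd.
  have d0 : 0 <= delta by rewrite mulr_ge0 ?exprn_ge0// ltW.
  pose s := 25 / 16 * delta.
  have s1 : s < 1 by rewrite /s; lra.
  have evR (i : 'I_n) : Normc.normc (eigenvalues (J + R))`_i < 5^-1.
    by apply: (eigenvalue_perturbed_lt R_le s1 n_gt0); exact: eigenvalue_nth.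
  have evP (i : 'I_n) : Normc.normc (eigenvalues (J + P))`_i < 5^-1.
    by apply: (eigenvalue_perturbed_lt P_le s1 n_gt0); exact: eigenvalue_nth.
  have trR N : \sum_(k < N) 5 ^+ k.+1 *
      Normc.normc (\sum_(i < n) (eigenvalues (J + R))`_i ^+ k.+1) <=
      n%:R * (s / (1 - s)).
    under eq_bigr do rewrite powerE.
    exact: sum_trace_powers_le R_le s1 N n_gt0.
  have trP N : \sum_(k < N) 5 ^+ k.+1 *
      Normc.normc (\sum_(i < n) (eigenvalues (J + P))`_i ^+ k.+1) <=
      n%:R * (s / (1 - s)).
    under eq_bigr do rewrite powerE.
    exact: sum_trace_powers_le P_le s1 N n_gt0.
  have sub4 : csupport (laplacian phi) `<=`
      [set p | Normc.normc (plane p) < 4^-1].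
    by move=> p /sub/andP[].
  have inner p : sqnorm p < 5^-1 ^+ 2 -> ~ csupport (laplacian phi) p.
    move=> p5 /sub/andP[ge _]; have {}ge : 5^-1 <= Num.sqrt (sqnorm p) := ge.
    move: p5; rewrite -(sqr_sqrtr (sqnorm_ge0 p)) ltNge.
    by rewrite lerXn2r ?nnegrE ?sqrtr_ge0.
  have lap_le := normc_laplacian_le sm.
  have L0 : (0 <= Linfty_norm (laplacian phi))%E.
    apply: le_trans (lap_le (0, 0)); rewrite lee_fin; exact: normc_ge0.
  (* An infinite norm makes the inequality trivial; otherwise the norm is a real number L. *)
  have [->|Loo] := eqVneq (Linfty_norm (laplacian phi)) +oo%E.
    by rewrite gt0_muley ?leey// lte_fin.
  have Lfin : Linfty_norm (laplacian phi) \is a fin_num.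
    by rewrite ge0_fin_numE// lt_neqAle Loo leey.
  set L := fine (Linfty_norm (laplacian phi)).
  have lapL q : Normc.normc (laplacian phi (plane q)) <= L.
    by rewrite -lee_fin fineK.
  have lapL_Re q : `|real_laplacian (Re_part phi) q| <= L.
    apply: le_trans (lapL q); rewrite laplacian_plane.
    exact: (@ler_normRe_normc K (_ +i* _)).
  have lapL_Im q : `|real_laplacian (Im_part phi) q| <= L.
    apply: le_trans (lapL q); rewrite laplacian_plane.
    exact: (@ler_normIm_normc K (_ +i* _)).
  have [C_Re C_Im] := sm 3.
  have zero q (q4 : 4^-1 ^+ 2 <= sqnorm q) := parts_eq0_outside sm cpt sub4 q4.
  have lap0 q (q5 : sqnorm q < 5^-1 ^+ 2) := real_laplacian_out (inner q q5).
  have boundRe := real_sum_bound C_Re (fun q h => (lap0 q h).1) lapL_Re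
    (fun q h => (zero q h).1) d3 nd d0 evR evP trR trP.
  have boundIm := real_sum_bound C_Im (fun q h => (lap0 q h).2) lapL_Im
    (fun q h => (zero q h).2) d3 nd d0 evR evP trR trP.
  have := normc_sum_parts_le boundRe boundIm.
  rewrite -(fineK Lfin) -/L -EFinM lee_fin.
  by have -> : 3 / 2 * L + 3 / 2 * L = 3 * L by field.
(* Every eigenvalue has modulus at least 1/4, where phi vanishes, so the sum is exactly 0. *)
rewrite big1; last first.
  move=> i _; apply: (phi_eq0_outside sm cpt sub).
  apply: (eigenvalue_perturbed_ge R_le n_gt0 eps_gt0 R_eq).
  - exact: n_eps_le g5 n_ge.
  - exact: pow4_div_eps_le g5 n_ge.
  - exact: eigenvalue_nth.
rewrite Normc.normc0 mule_ge0//; exact: Lnorm_ge0.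
Qed.
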